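(* Let $V\in C^1(\mathbb{R}^n;\mathbb{R}_+)$, $\theta\in C^1(\mathbb{R}^n;\mathbb{R})$ be given functions with locally Lipschitz partial derivatives and suppose that $$S:=\{x\in\mathbb{R}^n:|\nabla V(x)|=0\}=\{x\in\mathbb{R}^n:V(x)=0\}.$$ Suppose that for every $z\in\mathbb{R}^n$ and for every $y\in\{x\in\mathbb{R}^n:V(x)\le V(z)\}$ the set $\{x\in\mathbb{R}^n:V(x)\le V(z),\ \theta(x)\le\theta(y)\}$ is compact. Let $\Omega\in C^0(\mathbb{R}^n;\mathbb{R}_+)$ be a locally Lipschitz function with $\Omega(x)>0$ for $x\notin S$ and $\Omega(x)=0$ for all $x\in S$. Suppose that there exist a function $\gamma\in C^0(\tilde S;(0,+\infty))$, where $\tilde S=\{x\in\mathbb{R}^n:\Omega(x)<1\}$, and a locally Lipschitz vector field $F:\tilde S\to\mathbb{R}^n$ such that $$\gamma(x)|\nabla V(x)|^2\ge V(x)\quad\text{for all } x\in\mathbb{R}^n\text{ with }\Omega(x)<1,$$ $$\nabla V(x)F(x)\le0,\quad \nabla\theta(x)F(x)\le0\quad\text{for all } x\in\mathbb{R}^n\text{ with }\Omega(x)<1.$$ Finally, suppose that there exists a locally Lipschitz function $\psi:\mathbb{R}^n\to(0,+\infty)$ for which the following property holds: for every $z\in\mathbb{R}^n$ there exists $y_z\in\{x\in\mathbb{R}^n:V(x)\le V(z)\}$ with $\theta(y_z)\ge\theta(z)$ such that $$\{x\in\mathbb{R}^n:a(x)>0,\ V(x)\le V(z)\}\subseteq\{x\in\mathbb{R}^n:\theta(x)\le\theta(y_z)\},$$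 where $$a(x):=-\psi(x)\nabla V(x)(\nabla\theta(x))'-|\nabla V(x)|^2|\nabla\theta(x)|^2+\left|\nabla V(x)(\nabla\theta(x))'\right|^2 .$$ Let $\beta>1$ be a constant, $\sigma:\mathbb{R}^n\to(0,+\infty)$ be a locally Lipschitz function and define the locally Lipschitz vector field $f:\mathbb{R}^n\to\mathbb{R}^n$ by $$f(x):=\sigma(x)(1-\beta\Omega(x))F(x)-\beta\sigma(x)\Omega(x)\psi(x)(\nabla V(x))'-\beta\sigma(x)\Omega(x)\left(|\nabla V(x)|^2I_n-(\nabla V(x))'\nabla V(x)\right)(\nabla\theta(x))'$$ for all $x\in\mathbb{R}^n$ with $\beta\Omega(x)<1$, and $$f(x):=-\sigma(x)\psi(x)(\nabla V(x))'-\sigma(x)\left(|\nabla V(x)|^2I_n-(\nabla V(x))'\nabla V(x)\right)(\nabla\theta(x))'$$ for all $x\in\mathbb{R}^n$ with $\beta\Omega(x)\ge1$. Then: - For every $x_0\in\mathbb{R}^n$ the unique solution $x(t)$ of $\dot x=f(x)$ with $x(0)=x_0$ is defined for all $t\ge0$ and is bounded. - The set $S$ is positively invariant for $\dot x=f(x)$. - If $\omega(x_0)$ denotes the positive limit set of $\{x(t):t\ge0\}$, then for every $x_0\in\mathbb{R}^n$, $\omega(x_0)$ is a non-empty, compact, connected, invariant set which satisfies $\omega(x_0)\subseteq\{x\in S:\nabla\theta(x)F(x)=0\}$. - Every point $x^*\in S$ for which $F(x^* )=0$ and for which there is a constant $\tilde\delta>0$ such that $\theta(x^* )<\theta(x)$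 for all $x\in S\setminus\{x^*\}$ with $|x-x^*|<\tilde\delta$ and $\{x\in S:\nabla\theta(x)F(x)=0,\ |x-x^*|<\tilde\delta\}=\{x^*\}$, is a locally asymptotically stable equilibrium point of $\dot x=f(x)$.
   Context: Gradients are row vectors; a prime denotes transpose; $|\cdot|$ is the Euclidean norm; $I_n$ is the $n\times n$ identity matrix; $\mathbb{R}_+=[0,+\infty)$. The positive limit set $\omega(x_0)$ is the set of all $p\in\mathbb{R}^n$ for which there is a sequence $t_i\to+\infty$ with $x(t_i)\to p$. A set is invariant if the solution of $\dot x=f(x)$ starting at any of its points exists for all $t\in\mathbb{R}$ and stays in the set; positively invariant if solutions starting in it stay in it for all $t\ge0$. *)

(* Defs.v *)
From HB Require Import structures.
From mathcomp Require Export all_boot all_order all_algebra.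
From mathcomp Require Export all_classical all_reals all_analysis.

Set Implicit Arguments.
Unset Strict Implicit.
Unset Printing Implicit Defensive.

Export Order.TTheory GRing.Theory Num.Theory.
Export numFieldNormedType.Exports.

Local Open Scope classical_set_scope.
Local Open Scope ring_scope.

(* Points of R^n are row vectors, like gradients; a product "row times column"
   u v' is [dotr u v]. The library norm [`|u|] on ['rV_n] is the sup norm: it is
   used only through notions that do not depend on the choice of a norm on R^n
   (convergence, differentiability, boundedness, local Lipschitz continuity). *)

Section calculus.
Context {R : realType} {n : nat}.
Implicit Types (u v x : 'rV[R]_n) (V : 'rV[R]_n -> R).

Definition dotr u v : R := (u *m v^T) 0 0.

Definition enorm u : R := Num.sqrt (dotr u u).

Definition partial (j : 'I_n) V x : R := 'D_(delta_mx 0 j) V x.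

Definition grad V x : 'rV[R]_n := \row_j partial j V x.

Definition C1 V : Prop :=
  (forall x, differentiable V x) /\ (forall j, continuous (partial j V)).

Definition locally_lipschitz {W : normedModType R} (A : set 'rV[R]_n)
    (g : 'rV[R]_n -> W) : Prop :=
  forall x, A x -> exists2 U, nbhs x U & [lipschitz g y | y in U `&` A].

End calculus.

Section ode.
Context {R : realType} {n : nat}.
Implicit Types (f : 'rV[R]_n -> 'rV[R]_n) (x : R -> 'rV[R]_n).
Implicit Types (p q : 'rV[R]_n) (A : set 'rV[R]_n).

(* The derivative is taken relatively to the interval I, hence is one-sided at
   an endpoint of I that belongs to I. *)
Definition is_solution f (I : set R) x : Prop :=
  forall t, I t ->
    (s - t)^-1 *: (x s - x t) @[s --> within I t^'] --> f (x t).

(* x is, on the interval I, the unique solution with x(0) = p; uniqueness is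
   also required against solutions that are defined on a smaller interval. *)
Definition unique_solution f p (I : set R) x : Prop :=
  [/\ is_solution f I x, x 0 = p &
      forall (J : set R) (y : R -> 'rV[R]_n),
        is_interval J -> J 0 -> J `<=` I ->
        is_solution f J y -> y 0 = p -> forall t, J t -> y t = x t].

Definition invariant_set f A : Prop :=
  forall p, A p ->
    exists2 x, unique_solution f p setT x & forall t, A (x t).

Definition positively_invariant f A : Prop :=
  forall p, A p ->
    exists2 x, unique_solution f p `[0, +oo[ x & forall t, 0 <= t -> A (x t).

Definition omega_limit x : set 'rV[R]_n :=
  [set p | exists2 t : nat -> R, t @ \oo --> +oo & x (t i) @[i --> \oo] --> p].

Definition equilibrium f p : Prop := f p = 0.

Definition lyapunov_stable f p : Prop :=
  forall e : R, 0 < e -> exists2 d : R, 0 < d &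
    forall q, enorm (q - p) < d ->
      exists2 x, unique_solution f q `[0, +oo[ x &
        forall t, 0 <= t -> enorm (x t - p) < e.

Definition locally_attractive f p : Prop :=
  exists2 d : R, 0 < d &
    forall q, enorm (q - p) < d ->
      exists2 x, unique_solution f q `[0, +oo[ x & x t @[t --> +oo] --> p.

Definition locally_asymptotically_stable f p : Prop :=
  [/\ equilibrium f p, lyapunov_stable f p & locally_attractive f p].

End ode.

Section vector_field.
Context {R : realType} {n : nat}.
Variables (V theta : 'rV[R]_n -> R).

Definition afun (psi : 'rV[R]_n -> R) (x : 'rV[R]_n) : R :=
  - psi x * dotr (grad V x) (grad theta x)
  - enorm (grad V x) ^+ 2 * enorm (grad theta x) ^+ 2
  + `|dotr (grad V x) (grad theta x)| ^+ 2.

(* (|grad V|^2 I_n - (grad V)' grad V) (grad theta)', written as a row vector *)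
Definition tangential (x : 'rV[R]_n) : 'rV[R]_n :=
  (((enorm (grad V x) ^+ 2)%:M - (grad V x)^T *m grad V x)
     *m (grad theta x)^T)^T.

(* F is given on the set Omega < 1 only; its values elsewhere are not used,
   since beta > 1. *)
Definition vfield (Omega psi sigma : 'rV[R]_n -> R)
    (F : 'rV[R]_n -> 'rV[R]_n) (beta : R) (x : 'rV[R]_n) : 'rV[R]_n :=
  if beta * Omega x < 1 then
    (sigma x * (1 - beta * Omega x)) *: F x
    - (beta * sigma x * Omega x * psi x) *: grad V x
    - (beta * sigma x * Omega x) *: tangential x
  else
    - (sigma x * psi x) *: grad V x - sigma x *: tangential x.

End vector_field.

(* Main.v *)
Require Import Defs.
From mathcomp Require Import ring lra.

(* The field is [f = sigma (1 - m) F - sigma m (psi grad V + T)] with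
   [m = min 1 (beta Omega)] and [T] the tangential part of [grad theta], which is
   orthogonal to [grad V]. Hence [V' <= - sigma m psi |grad V|^2] and
   [theta' <= sigma m a] along solutions, so that solutions never leave the
   compact set [V <= V z, theta <= theta y_z]: [theta] cannot increase where it
   exceeds [theta y_z]. On a limit set [V] is constant, which forces it into [S].
   The function [theta] need not be monotone, but near [S] the inequality
   [gamma |grad V|^2 >= V] yields a constant [K] such that
   [theta + K sqrt V] is nonincreasing; it equals [theta] on [S], hence [theta]
   is constant on limit sets, and it serves as a Lyapunov function for the
   stability of a strict local minimizer of [theta] on [S]. *)

Set Implicit Arguments.
Unset Strict Implicit.
Unset Printing Implicit Defensive.

Local Open Scope classical_set_scope.
Local Open Scope ring_scope.

(** * Real calculus *)

Section real_calculus.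
Context {R : realType}.
Implicit Types (a b t : R).

(** The difficulty is that every rate degenerates: [m] vanishes on [S], so neither the decay of [V]
    nor the possible growth of [theta] has a uniform speed. What makes them comparable is that, by
    Cauchy-Schwarz, both estimates carry the same factor c = sigma m psi: V' <= - c |grad V|^2 and
    theta' <= c |grad V| |grad theta|. Dividing V' by 2 sqrt V and using sqrt V <= sqrt gamma |grad
    V| makes the decay of sqrt V linear in |grad V| as well, and c drops out of the comparison. As
    [gamma] is only bounded on compact subsets of {Omega < 1}, the constant [K] depends on such a
    subset; hence it is applied to the tail of a solution, or near an equilibrium, but not to a
    whole trajectory. *)

Lemma derive_le0_nincr (h dh : R -> R) a b : a <= b ->
  {within `[a, b], continuous h} ->
  (forall t, a < t < b -> is_derive t 1 h (dh t)) ->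
  (forall t, a < t < b -> dh t <= 0) -> h b <= h a.
Proof.
rewrite le_eqVlt => /predU1P[-> //|ab] hc hd dh0.
have hd' t : t \in `]a, b[ -> is_derive t 1 h (dh t).
  by rewrite in_itv/=; exact: hd.
have [c cab e] := MVT ab hd' hc.
by rewrite -subr_le0 e mulr_le0_ge0 ?dh0 ?subr_ge0 ?ltW// -in_itv.
Qed.

Lemma is_derive_continuous {W : normedModType R} (x : R -> W) t v :
  is_derive t 1 x v -> {for t, continuous x}.
Proof. by move=> xt; apply/differentiable_continuous/derivable1_diffP; case: xt. Qed.

Lemma is_derive_within {W : normedModType R} (x dx : R -> W) a b :
  (forall t, a <= t <= b -> is_derive t 1 x (dx t)) ->
  {within `[a, b], continuous x}.
Proof.
move=> xd; apply: continuous_in_subspaceT => t /set_mem/=; rewrite in_itv/=.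
by move=> /xd/is_derive_continuous.
Qed.

(** Bridge between the derivative, a quotient in an increment tending to 0, and the slope by which
    [is_solution] is defined. *)
Lemma is_derive_slope {W : normedModType R} (x : R -> W) t v :
  is_derive t 1 x v <->
  (s - t)^-1 *: (x s - x t) @[s --> t^'] --> v.
Proof.
have E : ((s - t)^-1 *: (x s - x t) @[s --> t^']) =
         (h^-1 *: ((x \o shift t) (h *: (1:R)) - x t) @[h --> (0:R)^']).
  rewrite /= eqEsubset; split => A /=; rewrite /fmap/= /dnbhs/= /within/=.
  - move=> /nbhs_ballP[e /= e0 H]; apply/nbhs_ballP; exists e => //= h.
    rewrite /ball/= sub0r normrN => he h0.
    have := H (h + t); rewrite /ball/= addrK; rewrite [h *: 1]mulr1; apply.
      by rewrite opprD addrCA subrr addr0 normrN.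
    by rewrite -subr_eq0 addrK.
  - move=> /nbhs_ballP[e /= e0 H]; apply/nbhs_ballP; exists e => //= s.
    rewrite /ball/= => he h0.
    have := H (s - t); rewrite /ball/= [_ *: 1]mulr1 subrK; apply.
      by rewrite sub0r opprB.
    by rewrite subr_eq0.
rewrite E; split=> [[d <-]//|H]; split; first by apply/cvg_ex; exists v.
exact: cvg_lim.
Qed.

(** A quadratic remainder bound, unlike differentiability, survives pointwise limits; this is how
    the limit of the Picard iterates is differentiated. *)
Lemma is_derive_quad {W : normedModType R} (x : R -> W) t v C :
  (forall s, `|x s - x t - (s - t) *: v| <= C * `|s - t| ^+ 2) ->
  is_derive t 1 x v.
Proof.
move=> H; apply/is_derive_slope/cvgrPdist_le => e e0.
have C1 : 0 < `|C| + 1 by rewrite ltr_wpDl.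
near=> s.
have st : s != t by near: s; exact: nbhs_dnbhs_neq.
have st0 : s - t != 0 by rewrite subr_eq0.
have -> : v - (s - t)^-1 *: (x s - x t) =
  - ((s - t)^-1 *: (x s - x t - (s - t) *: v)).
  by rewrite [in RHS]scalerBr scalerA mulVf// scale1r opprB.
rewrite normrN normrZ normfV ler_pdivrMl ?normr_gt0//.
apply: le_trans (H s) _.
apply: (@le_trans _ _ ((`|C| + 1) * `|s - t| ^+ 2)).
  by rewrite ler_wpM2r ?sqr_ge0// (le_trans (ler_norm _))// lerDl.
rewrite expr2 mulrA mulrC ler_wpM2l// mulrC -ler_pdivlMr//.
near: s; apply: nbhs_dnbhs; apply/nbhs_ballP.
exists (e / (`|C| + 1)) => /=; first by rewrite divr_gt0.
by move=> s /=; rewrite /ball/= distrC => /ltW.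
Unshelve. all: by end_near. Qed.

Lemma antiderivative_right (g : R -> R) a : continuous g ->
  exists G : R -> R, forall t, a < t -> is_derive t 1 G (g t).
Proof.
move=> cg; exists (fun x => \int[lebesgue_measure]_(t in `[a, x]) g t)%R => t at_.
have [] := @continuous_FTC1_closed R g a t (t + 1) _ _ at_ (cg t).
- by rewrite ltrDl.
- apply: continuous_compact_integrable; first exact: segment_compact.
  exact: continuous_subspaceT.
- by move=> d e; split => //; rewrite -derive1E.
Qed.

Lemma is_derive_eq_diff (G H g : R -> R) a b : a <= b ->
  (forall t, a <= t <= b -> is_derive t 1 G (g t)) ->
  (forall t, a <= t <= b -> is_derive t 1 H (g t)) ->
  G b - G a = H b - H a.
Proof.
move=> ab dG dH.
have D t : a <= t <= b -> is_derive t 1 (G - H) (g t - g t).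
  by move=> tab; apply: is_deriveB; [exact: dG|exact: dH].
have D' t : a <= t <= b -> is_derive t 1 (H - G) (g t - g t).
  by move=> tab; apply: is_deriveB; [exact: dH|exact: dG].
have W t : a < t < b -> a <= t <= b by case/andP => *; rewrite !ltW.
have Z t : a < t < b -> g t - g t <= 0 by rewrite subrr.
have := derive_le0_nincr ab (is_derive_within D) (fun t h => D t (W t h)) Z.
have := derive_le0_nincr ab (is_derive_within D') (fun t h => D' t (W t h)) Z.
by rewrite !fctE; lra.
Qed.

(** Integrals based at -(k+1) are antiderivatives to the right of that point only. Normalised to
    vanish at 0, any two agree where both are valid, so the index may depend on [t] and be frozen in
    a neighbourhood of [t]. *)
Lemma antiderivative (g : R -> R) : continuous g ->
  exists G : R -> R, G 0 = 0 /\ forall t, is_derive t 1 G (g t).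
Proof.
move=> cg.
pose Gn (k : nat) := sval (cid (antiderivative_right (- k.+1%:R) cg)).
have dGn k t : - k.+1%:R < t -> is_derive t 1 (Gn k) (g t).
  exact: (svalP (cid (antiderivative_right (- k.+1%:R) cg)) t).
have same k l t : - k.+1%:R < t -> - l.+1%:R < t -> Gn k t - Gn k 0 = Gn l t - Gn l 0.
  move=> kt lt.
  have k0 : - k.+1%:R < 0 :> R by rewrite oppr_lt0.
  have l0 : - l.+1%:R < 0 :> R by rewrite oppr_lt0.
  have [t0|t0] := leP 0 t.
    by apply: is_derive_eq_diff t0 _ _ => s /andP[s0 st]; apply: dGn;
      exact: lt_le_trans s0.
  suff : Gn k 0 - Gn k t = Gn l 0 - Gn l t by lra.
  by apply: is_derive_eq_diff (ltW t0) _ _ => s /andP[s0 st]; apply: dGn;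
      exact: lt_le_trans s0.
pose N t := Num.truncn `|t|.
have Nt t : - (N t).+1%:R < t.
  have : `|t| < (N t).+1%:R by rewrite /N truncnS_gt.
  by rewrite ltr_norml => /andP[].
exists (fun t => Gn (N t) t - Gn (N t) 0); split; first by rewrite subrr.
move=> t.
have dG : is_derive t 1 (Gn (N t) - cst (Gn (N t) 0)) (g t - 0).
  by apply: is_deriveB; exact: dGn.
rewrite subr0 in dG.
have E : \forall s \near t, (Gn (N t) - cst (Gn (N t) 0)) s = Gn (N s) s - Gn (N s) 0.
  near=> s; rewrite !fctE; apply: same => //.
  by near: s; exact: lt_nbhsr.
exact: near_eq_is_derive E dG.
Unshelve. all: by end_near. Qed.

End real_calculus.

(** * Picard iteration in row vectors *)

Lemma is_derive_mull {R : realType} (c t : R) :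
  is_derive t 1 (fun s => c * s) c.
Proof.
have := @is_deriveZ R R R^o id c t 1 1 _; rewrite [c *: 1]mulr1; exact.
Qed.

Section row_vectors.
Context {R : realType} {n : nat}.
Implicit Types (u v p : 'rV[R]_n) (x dx : R -> 'rV[R]_n) (a b t : R).

Lemma rV_norm_le u c : 0 <= c -> (`|u| <= c) <-> (forall i, `|u 0 i| <= c).
Proof.
move=> c0; rewrite [X in X <= c]/Num.Def.normr/= mx_normrE; split.
  move=> uc i; apply: le_trans uc.
  exact: (le_bigmax _ (fun ij : 'I_1 * 'I_n => `|u ij.1 ij.2|) (0, i)).
by move=> uc; apply: bigmax_le => //= -[i j] _ /=; rewrite (ord1 i).
Qed.

Lemma rV_coord_le u i : `|u 0 i| <= `|u|.
Proof. exact: ((rV_norm_le u (normr_ge0 u)).1 (lexx _)). Qed.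

Lemma is_derive_rVP x t v :
  is_derive t 1 x v <-> (forall i, is_derive t 1 (fun s => x s 0 i) (v 0 i)).
Proof.
split=> [[xt xv] i|H].
  split; first by move/derivable_mxP : xt => /(_ 0 i).
  by have := derive_mx xt; rewrite xv => ->; rewrite mxE.
have xt : derivable x t 1.
  by apply/derivable_mxP => j i; rewrite (ord1 j); case: (H i).
split=> //; rewrite derive_mx//; apply/rowP => i; rewrite mxE.
by case: (H i).
Qed.

Lemma rV_antiderivative (g : R -> 'rV[R]_n) p : continuous g ->
  exists G : R -> 'rV[R]_n, G 0 = p /\ forall t, is_derive t 1 G (g t).
Proof.
move=> cg.
have cgi i : continuous (fun t => g t 0 i).
  move=> t; apply: (@continuous_comp _ _ _ g (fun u : 'rV[R]_n => u 0 i)) => //.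
    exact: cg.
  exact: coord_continuous.
pose G t : 'rV[R]_n := \row_i (p 0 i + sval (cid (antiderivative (cgi i))) t).
exists G; split.
  apply/rowP => i; rewrite mxE.
  by have [-> _] := svalP (cid (antiderivative (cgi i))); rewrite addr0.
move=> t; apply/is_derive_rVP => i.
have [_ /(_ t)] := svalP (cid (antiderivative (cgi i))).
set h := sval _ => dh.
have -> : (fun s => G s 0 i) = cst (p 0 i) + h.
  by apply/funext => s; rewrite mxE.
by rewrite -[g t 0 i]add0r; exact: is_deriveD.
Qed.

(** Mean value inequality, reduced to coordinates because the norm is the sup norm. The bound is a
    function rather than a constant so that the exponential weight of the Picard iteration can be
    integrated. *)
Lemma rV_increment_le x dx (phi dphi : R -> R) a b : a <= b ->
  (forall t, a <= t <= b -> is_derive t 1 x (dx t)) ->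
  (forall t, a <= t <= b -> is_derive t 1 phi (dphi t)) ->
  (forall t, a <= t <= b -> `|dx t| <= dphi t) ->
  `|x b - x a| <= phi b - phi a.
Proof.
move=> ab dxE dphiE le_d.
have W t : a < t < b -> a <= t <= b by case/andP => *; rewrite !ltW.
have dpos t : a <= t <= b -> 0 <= dphi t.
  by move=> /le_d; exact: le_trans.
have dN t : a <= t <= b -> is_derive t 1 (- phi) (- dphi t).
  by move=> tab; apply: is_deriveN; exact: dphiE.
apply/rV_norm_le.
  have N t : a < t < b -> - dphi t <= 0 by move=> /W/dpos; rewrite oppr_le0.
  have := derive_le0_nincr ab (is_derive_within dN) (fun t h => dN t (W t h)) N.
  by rewrite !fctE lerN2 subr_ge0.
move=> i.
have di t : a <= t <= b -> is_derive t 1 (fun s => x s 0 i) (dx t 0 i).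
  by move=> tab; move/is_derive_rVP : (dxE t tab) => /(_ i).
have d1 t : a <= t <= b ->
    is_derive t 1 ((fun s => x s 0 i) - phi) (dx t 0 i - dphi t).
  by move=> tab; apply: is_deriveB; [exact: di|exact: dphiE].
have d2 t : a <= t <= b ->
    is_derive t 1 (- (fun s => x s 0 i) - phi) (- dx t 0 i - dphi t).
  move=> tab; apply: is_deriveB; last exact: dphiE.
  by apply: is_deriveN; exact: di.
have bnd t : a <= t <= b -> `|dx t 0 i| <= dphi t.
  by move=> tab; exact: le_trans (rV_coord_le _ _) (le_d _ tab).
have h1 : ((fun s => x s 0 i) - phi) b <= ((fun s => x s 0 i) - phi) a.
  apply: (derive_le0_nincr ab (is_derive_within d1) (fun t h => d1 t (W t h))).
  by move=> t /W/bnd; rewrite ler_norml => /andP[_]; lra.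
have h2 : (- (fun s => x s 0 i) - phi) b <= (- (fun s => x s 0 i) - phi) a.
  apply: (derive_le0_nincr ab (is_derive_within d2) (fun t h => d2 t (W t h))).
  by move=> t /W/bnd; rewrite ler_norml => /andP[+ _]; lra.
by rewrite !mxE; move: h1 h2; rewrite !fctE ler_norml => *; apply/andP; split; lra.
Qed.

Lemma rV_increment_cst x dx M a b : a <= b ->
  (forall t, a <= t <= b -> is_derive t 1 x (dx t)) ->
  (forall t, a <= t <= b -> `|dx t| <= M) ->
  `|x b - x a| <= M * (b - a).
Proof.
move=> ab dxE le_d.
rewrite mulrBr.
apply: (@rV_increment_le x dx (fun t => M * t) (fun=> M) a b ab dxE _ le_d).
by move=> t _; exact: is_derive_mull.
Qed.

Lemma rV_cvg {T : Type} (G : set_system T) {FG : Filter G} (h : T -> 'rV[R]_n) v :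
  (forall i, h s 0 i @[s --> G] --> v 0 i) -> h s @[s --> G] --> v.
Proof.
move=> H; apply/cvgrPdist_le => e e0.
have : \forall s \near G, forall i, `|v 0 i - h s 0 i| <= e.
  by apply: filter_forall => i; move: e e0; apply/cvgrPdist_le; exact: H.
apply: filterS => s Hs; apply/(rV_norm_le _ (ltW e0)) => i.
by have := Hs i; rewrite !mxE.
Qed.

(** Each coordinate is a telescoping series dominated by a geometric one. *)
Lemma rV_cvg_geometric (u : nat -> 'rV[R]_n) (C : R) : 0 <= C ->
  (forall k, `|u k.+1 - u k| <= C * 2^-1 ^+ k) ->
  exists l : 'rV[R]_n, u k @[k --> \oo] --> l.
Proof.
move=> C0 H.
have ci i : cvgn (fun k => u k 0 i).
  pose d k : R := u k.+1 0 i - u k 0 i.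
  have -> : (fun k => u k 0 i) = (fun k => u 0%N 0 i + series d k).
    by apply/funext => k; rewrite /series/= telescope_sumr// addrC subrK.
  apply: is_cvgD; first exact: is_cvg_cst.
  apply: (@normed_cvg R R^o).
  apply: (@series_le_cvg _ _ (fun k => C * 2^-1 ^+ k)).
  - by move=> k; exact: normr_ge0.
  - by move=> k; rewrite mulr_ge0// exprn_ge0.
  - move=> k; apply: le_trans (H k); apply: le_trans (rV_coord_le _ i).
    by rewrite !mxE.
  by apply: is_cvg_geometric_series; rewrite gtr0_norm ?invf_lt1 ?ltr1n.
exists (\row_i lim (u k 0 i @[k --> \oo])); apply: rV_cvg => i.
by rewrite mxE; exact: ci.
Qed.

(** * Global solutions of a bounded, globally Lipschitz field *)

Section picard.
Variables (f : 'rV[R]_n -> 'rV[R]_n) (L M : R).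
Hypothesis L_gt0 : 0 < L.
Hypothesis f_lip : forall u v, `|f u - f v| <= L * `|u - v|.
Hypothesis f_bnd : forall u, `|f u| <= M.

Lemma lipschitz_continuous : continuous f.
Proof.
move=> u; apply/(@cvgrPdist_le _ _ _ _ (nbhs_filter u)) => e e0.
have : \forall v \near u, ball u (e / L) v by apply: nbhsx_ballx; rewrite divr_gt0.
apply: filterS => v; rewrite -ball_normE/= => /ltW; rewrite ler_pdivlMr// mulrC.
exact: le_trans.
Qed.

(* Even weight, so that forward and backward times are treated at once. *)
Let w t := expR (2 * L * t) + expR (- (2 * L * t)).
Let E t := (2 * L)^-1 * (expR (2 * L * t) - expR (- (2 * L * t))).

Let L2 : 2 * L != 0. Proof. by rewrite mulf_neq0// gt_eqF. Qed.

Let w_ge1 t : 1 <= w t.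
Proof.
rewrite /w; have [t0|t0] := leP 0 (2 * L * t).
  apply: le_trans (_ : expR (2 * L * t) <= _).
    by apply: le_trans (expR_ge1Dx _); rewrite lerDl.
  by rewrite lerDl expR_ge0.
apply: le_trans (_ : expR (- (2 * L * t)) <= _).
  by apply: le_trans (expR_ge1Dx _); rewrite lerDl oppr_ge0 ltW.
by rewrite lerDr expR_ge0.
Qed.

Let dE t : is_derive t 1 E (w t).
Proof.
have d1 : is_derive t 1 (fun s : R => 2 * L * s) (2 * L).
  exact: is_derive_mull.
have d2 : is_derive t 1 (fun s : R => - (2 * L * s)) (- (2 * L)).
  exact: is_deriveN.
have e1 := is_derive1_comp (is_derive_expR (2 * L * t)) d1.
have e2 := @is_derive1_comp _ expR (fun s => - (2 * L * s)) _ _ _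
  (is_derive_expR (- (2 * L * t))) d2.
have -> : w t = (2 * L)^-1 *: ((expR (2 * L * t) * (2 * L) -
    expR (- (2 * L * t)) * - (2 * L)) : R^o).
  rewrite /w mulrN opprK -mulrDl /GRing.scale/= [_ * (2 * L)]mulrC mulrA.
  by rewrite mulVf ?mul1r.
exact: (@is_deriveZ R R R^o _ (2 * L)^-1 _ _ _ (is_deriveB e1 e2)).
Qed.

Let E0 : E 0 = 0. Proof. by rewrite /E mulr0 oppr0 subrr mulr0. Qed.

Let E_le t : `|E t| <= (2 * L)^-1 * w t.
Proof.
have L0 : 0 < (2 * L)^-1 by rewrite invr_gt0 mulr_gt0.
rewrite /E normrM gtr0_norm// ler_pM2l// ler_norml /w.
have := expR_ge0 (2 * L * t); have := expR_ge0 (- (2 * L * t)).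
by move=> *; apply/andP; split; lra.
Qed.

(** The iterates are compared in a Bielecki norm: integrating the weight [w] gains 1/(2L) against
    the Lipschitz constant L, so each iteration halves the bound and convergence holds for all
    times, without restriction to short intervals. *)
Lemma picard p : exists x : R -> 'rV[R]_n,
  x 0 = p /\ forall t, is_derive t 1 x (f (x t)).
Proof.
(* Stated for every curve, with a dummy value at the discontinuous ones, so that [choice] yields a
   total operator that can be iterated. *)
have step (y : R -> 'rV[R]_n) : exists Py : R -> 'rV[R]_n, continuous y ->
    Py 0 = p /\ forall t, is_derive t 1 Py (f (y t)).
  have [cy|] := pselect (continuous y); last by exists y.
  have [|G HG] := @rV_antiderivative (f \o y) p.
    by move=> t; apply: continuous_comp; [exact: cy|exact: lipschitz_continuous].
  by exists G.
have [P HP] := choice step.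
pose X k : R -> 'rV[R]_n := iter k P (cst p).
have cX k : continuous (X k).
  elim: k => [|k IH]; first by move=> t; exact: cst_continuous.
  by move=> t; apply: is_derive_continuous; apply: (HP _ IH).2.
have X0 k : X k 0 = p by case: k => // k; exact: (HP _ (cX k)).1.
have dX k t : is_derive t 1 (X k.+1) (f (X k t)) by exact: (HP _ (cX k)).2.
pose dx k t : 'rV[R]_n := if k is k'.+1 then f (X k' t) else 0.
have dXx k t : is_derive t 1 (X k) (dx k t).
  by case: k => [|k]; [exact: is_derive_cst|exact: dX].
have M0 : 0 <= M by exact: le_trans (f_bnd 0).
have dx_le k t : `|dx k t| <= M by case: k => [|k] /=; rewrite ?normr0.
pose c k := M * 2^-1 ^+ k.
have c0 k : 0 <= c k by rewrite mulr_ge0// exprn_ge0.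
have step_le k : (forall t, `|dx k.+1 t - dx k t| <= c k * w t) ->
    forall t, `|X k.+1 t - X k t| <= c k * `|E t|.
  move=> H t.
  have dD (s : R) : is_derive s 1 (X k.+1 - X k) (dx k.+1 s - dx k s).
    exact: is_deriveB.
  have dcE (s : R) : is_derive s 1 (fun s => c k * E s) (c k * w s).
    exact: (@is_deriveZ R R R^o E (c k) s 1 (w s) (dE s)).
  have [t0|t0] := leP 0 t.
    have := @rV_increment_le _ _ _ _ 0 t t0 (fun s _ => dD s) (fun s _ => dcE s)
      (fun s _ => H s).
    rewrite !fctE !X0 subrr subr0 E0 mulr0 subr0 => /le_trans; apply.
    by rewrite ler_wpM2l ?ler_norm.
  have := @rV_increment_le _ _ _ _ t 0 (ltW t0) (fun s _ => dD s)
    (fun s _ => dcE s) (fun s _ => H s).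
  rewrite !fctE !X0 subrr sub0r normrN E0 mulr0 sub0r -mulrN => /le_trans; apply.
  by rewrite ler_wpM2l// -normrN ler_norm.
(* The induction runs on the derivatives: [step_le] integrates the bound to [E], and [E_le] returns
   to [w] with the factor 1/(2L). The base case is the bound [M] on [f], since [dx 0] is 0. *)
have main k : forall t, `|dx k.+1 t - dx k t| <= c k * w t.
  elim: k => [|k IH] t.
    rewrite subr0 /c expr0 mulr1; apply: le_trans (dx_le 1%N t) _.
    by rewrite ler_peMr.
  apply: le_trans (f_lip _ _) _.
  apply: (@le_trans _ _ (L * (c k * ((2 * L)^-1 * w t)))).
    rewrite ler_pM2l//; apply: le_trans (step_le _ IH t) _.
    by rewrite ler_wpM2l.
  rewrite le_eqVlt; apply/orP; left; apply/eqP.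
  rewrite /c exprS invfM; have : L != 0 by rewrite gt_eqF.
  by move=> L0; field.
have cvgX t : exists l : 'rV[R]_n, X k t @[k --> \oo] --> l.
  apply: (@rV_cvg_geometric _ (M * `|E t|)); first by rewrite mulr_ge0.
  by move=> k; apply: le_trans (step_le k (main k) t) _; rewrite /c mulrAC.
pose x t := sval (cid (cvgX t)).
have cx a : X k a @[k --> \oo] --> x a by exact: (svalP (cid (cvgX a))).
exists x; split.
  have := cx 0; have -> : X ^~ 0 = fun=> p by apply/funext => k; exact: X0.
  by move=> xp; apply: (cvg_unique _ xp); [exact: norm_hausdorff|exact: cvg_cst].
move=> t; apply: (@is_derive_quad _ _ _ _ _ (L * M)) => s.
have lipX k a b : `|X k a - X k b| <= M * `|a - b|.
  wlog ba : a b / b <= a.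
    move=> H; have [/H//|/ltW/H] := leP b a.
    by rewrite distrC [`|b - _|]distrC.
  rewrite (@ger0_norm _ (a - b)) ?subr_ge0//.
  exact: rV_increment_cst ba (fun t _ => dXx k t) (fun t _ => dx_le k t).
(* The constant is uniform in [k]: all iterates are [M]-Lipschitz in time, so the derivative of
   [X k.+1] moves by at most L M |s - t| between [t] and [s]. *)
have key k : `|X k.+1 s - X k.+1 t - (s - t) *: f (X k t)| <= L * M * `|s - t| ^+ 2.
  pose h (r : R) : 'rV[R]_n := X k.+1 r - r *: f (X k t).
  have dh (r : R) : is_derive r 1 h (f (X k r) - f (X k t)).
    apply: is_deriveB.
    apply/is_derive_rVP => i.
    have -> : (fun s0 : R => (s0 *: f (X k t)) 0 i) = (fun s => f (X k t) 0 i * s).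
      by apply/funext => z; rewrite mxE mulrC.
    exact: is_derive_mull.
  have -> : X k.+1 s - X k.+1 t - (s - t) *: f (X k t) = h s - h t.
    rewrite /h scalerBl [- (s *: _ - _)]opprB [- (X _ t - _)]opprD opprK.
    by rewrite [RHS]addrACA [- _ + _]addrC.
  have bd r : `|r - t| <= `|s - t| -> `|f (X k r) - f (X k t)| <= L * M * `|s - t|.
    move=> rs; apply: le_trans (f_lip _ _) _; rewrite -mulrA ler_pM2l//.
    by apply: le_trans (lipX _ _ _) _; rewrite ler_wpM2l.
  have [ts|st] := leP t s.
    rewrite expr2 mulrA {2}(@ger0_norm _ (s - t)) ?subr_ge0//.
    apply: rV_increment_cst ts (fun r _ => dh r) _ => r /andP[tr rs].
    by apply: bd; rewrite !ger0_norm; lra.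
  rewrite distrC expr2 mulrA {2}[`|s - t|]distrC (@gtr0_norm _ (t - s)) ?subr_gt0//.
  apply: rV_increment_cst (ltW st) (fun r _ => dh r) _ => r /andP[tr rs].
  by apply: bd; rewrite !ler0_norm; lra.
have cxS a : X k.+1 a @[k --> \oo] --> x a by rewrite (cvg_shiftS (X ^~ a)); exact: cx.
have cv : `|X k.+1 s - X k.+1 t - (s - t) *: f (X k t)| @[k --> \oo] -->
    `|x s - x t - (s - t) *: f (x t)|.
  apply: cvg_norm; apply: cvgB; first exact: cvgB.
  apply: cvgZ; first exact: cvg_cst.
  exact: (cvg_comp (X ^~ t) f (cx t) (@lipschitz_continuous (x t))).
rewrite -(cvg_lim _ cv)//; apply: limr_le; first by apply/cvg_ex; eexists; exact: cv.
exact: nearW.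
Qed.

End picard.
End row_vectors.

(** * Euclidean norm and Gronwall estimates *)

Section euclidean.
Context {R : realType} {n : nat}.
Implicit Types (u v w : 'rV[R]_n).

Lemma dotrE u v : dotr u v = \sum_i u 0 i * v 0 i.
Proof. by rewrite /dotr mxE; apply: eq_bigr => i _; rewrite mxE. Qed.

Lemma dotrC u v : dotr u v = dotr v u.
Proof. by rewrite !dotrE; apply: eq_bigr => i _; rewrite mulrC. Qed.

Lemma dotrDr u v w : dotr u (v + w) = dotr u v + dotr u w.
Proof. by rewrite !dotrE -big_split; apply: eq_bigr => i _; rewrite mxE mulrDr. Qed.

Lemma dotrZr u k v : dotr u (k *: v) = k * dotr u v.
Proof. by rewrite !dotrE mulr_sumr; apply: eq_bigr => i _; rewrite mxE mulrCA. Qed.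

Lemma dotrNr u v : dotr u (- v) = - dotr u v.
Proof. by rewrite -scaleN1r dotrZr mulN1r. Qed.

Lemma dotrBr u v w : dotr u (v - w) = dotr u v - dotr u w.
Proof. by rewrite dotrDr dotrNr. Qed.

Lemma dotr0 u : dotr u 0 = 0.
Proof. by rewrite -(scale0r u) dotrZr mul0r. Qed.

Lemma dotr_ge0 u : 0 <= dotr u u.
Proof. by rewrite dotrE sumr_ge0// => i _; rewrite -expr2 sqr_ge0. Qed.

Lemma enorm_ge0 u : 0 <= enorm u. Proof. exact: sqrtr_ge0. Qed.

Lemma sqr_enorm u : enorm u ^+ 2 = dotr u u.
Proof. by rewrite sqr_sqrtr// dotr_ge0. Qed.

Lemma coord_le_enorm u i : `|u 0 i| <= enorm u.
Proof.
rewrite -sqrtr_sqr ler_wsqrtr// dotrE (bigD1 i)//= -expr2 lerDl.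
by rewrite sumr_ge0// => j _; rewrite -expr2 sqr_ge0.
Qed.

Lemma norm_le_enorm u : `|u| <= enorm u.
Proof. by apply/(rV_norm_le _ (enorm_ge0 u)) => i; exact: coord_le_enorm. Qed.

Lemma enorm_eq0 u : enorm u = 0 -> u = 0.
Proof.
by move=> u0; apply/eqP; rewrite -normr_le0 -u0 norm_le_enorm.
Qed.

Lemma enorm0 : enorm (0 : 'rV[R]_n) = 0.
Proof. by rewrite /enorm dotr0 sqrtr0. Qed.

Lemma dotr_cauchy_schwarz u v : dotr u v ^+ 2 <= enorm u ^+ 2 * enorm v ^+ 2.
Proof.
rewrite !sqr_enorm; have [u0|u0] := eqVneq (dotr u u) 0.
  have -> : u = 0 by apply: enorm_eq0; rewrite /enorm u0 sqrtr0.
  by rewrite dotrC !dotr0 expr2 !mul0r.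
have up : 0 < dotr u u by rewrite lt_def u0 dotr_ge0.
(* This vector is |u|^2 times the component of [v] orthogonal to [u]; the scaling avoids a
   division. *)
have := dotr_ge0 (dotr u u *: v - dotr u v *: u).
rewrite dotrBr !dotrZr ![dotr (_ - _) _]dotrC !dotrBr !dotrZr [dotr v u]dotrC => H.
have : 0 <= dotr u u * (dotr u u * dotr v v - dotr u v ^+ 2) by lra.
by rewrite pmulr_rge0// subr_ge0.
Qed.

Lemma dotr_le_enorm u v : `|dotr u v| <= enorm u * enorm v.
Proof.
rewrite -ler_sqr ?nnegrE ?mulr_ge0 ?enorm_ge0//.
by rewrite real_normK ?num_real// exprMn dotr_cauchy_schwarz.
Qed.

Lemma dotr_continuous {T : topologicalType} (f g : T -> 'rV[R]_n) :
  continuous f -> continuous g -> continuous (fun x => dotr (f x) (g x)).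
Proof.
move=> cf cg x.
have -> : (fun x => dotr (f x) (g x)) =
    \sum_(i < n) ((fun x => f x 0 i) \* (fun x => g x 0 i)).
  by apply/funext => y; rewrite dotrE fct_sumE.
have cc (h : T -> 'rV[R]_n) i : continuous h -> continuous (fun x => h x 0 i).
  move=> ch y; apply: (cvg_comp h (fun u : 'rV[R]_n => u 0 i) (ch y)).
  exact: coord_continuous.
apply: (big_ind (fun F => {for x, continuous F})).
- exact: cst_continuous.
- by move=> F G cF cG; exact: continuousD.
- by move=> i _; apply: continuousM; exact: cc.
Qed.

Lemma enorm_continuous {T : topologicalType} (f : T -> 'rV[R]_n) :
  continuous f -> continuous (fun x => enorm (f x)).
Proof.
move=> cf x; apply: (cvg_comp (fun x => dotr (f x) (f x)) Num.sqrt).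
  exact: (dotr_continuous cf cf).
exact: sqrt_continuous.
Qed.

(** Passage between the sup-norm topology and the Euclidean distances in which stability is stated.
    One direction is [norm_le_enorm]; the other uses continuity of [enorm] instead of an explicit
    comparison constant. *)
Lemma nbhs_enorm_ball (p : 'rV[R]_n) (A : set 'rV[R]_n) :
  nbhs p A <-> exists2 d : R, 0 < d & forall q, enorm (q - p) < d -> A q.
Proof.
split=> [/nbhs_ballP[d /= d0 dA]|[d d0 dA]].
  exists d => // q qp; apply: dA; rewrite -ball_normE /= distrC.
  exact: le_lt_trans (norm_le_enorm _) qp.
have cs : continuous (fun q : 'rV[R]_n => q - p).
  by move=> q; apply: (@continuousB _ _ _ id (cst p) q) => //; exact: cst_continuous.
have ce := enorm_continuous cs.
have H : nbhs (enorm (p - p)) [set z | z < d].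
  by rewrite subrr enorm0; exact: lt_nbhsl.
exact: filterS dA (ce p _ H).
Qed.

Lemma is_derive_dotr (x : R -> 'rV[R]_n) (t : R) dx : is_derive t 1 x dx ->
  is_derive t 1 (fun s => dotr (x s) (x s)) (2 * dotr (x t) dx).
Proof.
move=> /is_derive_rVP H.
have -> : (fun s => dotr (x s) (x s)) = \sum_(i < n) (fun s => x s 0 i) ^+ 2.
  apply/funext => s; rewrite dotrE fct_sumE; apply: eq_bigr => i _.
  by rewrite expr2.
have -> : 2 * dotr (x t) dx = \sum_(i < n) (2%:R * x t 0 i ^+ 2.-1) *: dx 0 i.
  rewrite dotrE mulr_sumr; apply: eq_bigr => i _.
  by rewrite expr1 /GRing.scale/= mulrA.
by apply: is_derive_sum => i; exact: is_deriveX.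
Qed.

End euclidean.

(** Time reversal on [[a, b]]: it turns forward estimates into backward ones and last times into
    first times. *)
Lemma within_continuous_reflect {R : realType} (h : R -> R) (a b : R) :
  {within `[a, b], continuous h} ->
  {within `[a, b], continuous (fun s => h (a + b - s))}.
Proof.
move=> ch; apply/subspace_continuousP => s; rewrite /= in_itv/= => sab.
move/subspace_continuousP : ch => /(_ (a + b - s)); rewrite /= in_itv/=.
have -> : a <= a + b - s <= b by move: sab; lra.
move=> /(_ isT) H; apply: cvg_comp H.
move=> A; rewrite /within/= !near_simpl => /nbhs_ballP[e /= e0 HA].
apply/nbhs_ballP; exists e => //= z zs; rewrite !in_itv/= => zab.
apply: HA; last by rewrite in_itv/=; move: zab; lra.
move: zs; rewrite /ball/=; congr (_ < _).
by rewrite distrC; congr `|_|; lra.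
Qed.

(** * Gronwall estimates, forward and backward in time *)

Section gronwall.
Context {R : realType} {n : nat}.
Implicit Types (x y : R -> 'rV[R]_n).

(** The product of [h] and exp(- c t) is nonincreasing. *)
Lemma gronwall_scalar (h dh : R -> R) c a b : a <= b ->
  {within `[a, b], continuous h} ->
  (forall t, a < t < b -> is_derive t 1 h (dh t)) ->
  (forall t, a < t < b -> dh t <= c * h t) ->
  h b <= expR (c * (b - a)) * h a.
Proof.
move=> ab ch dhE dh_le.
have dexp (t : R) : is_derive t 1 (fun s => expR (- c * s)) (expR (- c * t) * - c).
  exact: (@is_derive1_comp _ expR (fun s => - c * s) _ _ _
    (is_derive_expR _) (is_derive_mull _ _)).
have cE : {within `[a, b], continuous (fun t => h t * expR (- c * t))}.
  have ce : {within `[a, b], continuous (fun s : R => expR (- c * s))}.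
    apply: continuous_subspaceT => s; exact: is_derive_continuous (dexp s).
  move=> t; exact: (@continuousM R (subspace `[a, b]) h
    (fun s : R => expR (- c * s)) t (ch t) (ce t)).
have := @derive_le0_nincr _ (fun t => h t * expR (- c * t))
  (fun t => h t * (expR (- c * t) * - c) + expR (- c * t) * dh t) a b ab cE.
have -> : expR (c * (b - a)) = expR (- c * a) / expR (- c * b).
  by rewrite -expRN -expRD; congr expR; lra.
rewrite mulrAC ler_pdivlMr ?expR_gt0// [_ * h a]mulrC; apply.
  by move=> t tab; apply: (@is_deriveM _ _ h (fun s => expR (- c * s))); exact: dhE.
move=> t /dh_le le_t; have := expR_gt0 (- c * t); set e := expR _ => e0.
have -> : h t * (e * - c) + e * dh t = e * (dh t - c * h t) by lra.
by rewrite pmulr_rle0// subr_le0.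
Qed.

(** The scalar estimate is applied to the squared Euclidean distance, which is differentiable. The
    factor [n] is the price of a Lipschitz constant in the sup norm, paid when the coordinates are
    summed. Reversing time gives the second inequality. *)
Lemma gronwall (g : 'rV[R]_n -> 'rV[R]_n) (L : R) x y a b : 0 <= L ->
  (forall u v, `|g u - g v| <= L * `|u - v|) -> a <= b ->
  {within `[a, b], continuous x} -> {within `[a, b], continuous y} ->
  (forall t, a < t < b -> is_derive t 1 x (g (x t))) ->
  (forall t, a < t < b -> is_derive t 1 y (g (y t))) ->
  enorm (x b - y b) <= expR (n%:R * L * (b - a)) * enorm (x a - y a) /\
  enorm (x a - y a) <= expR (n%:R * L * (b - a)) * enorm (x b - y b).
Proof.
move=> L0 gL ab cx cy dx dy.
pose h t := dotr (x t - y t) (x t - y t).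
pose dh t := 2 * dotr (x t - y t) (g (x t) - g (y t)).
have ch : {within `[a, b], continuous h}.
  by apply: dotr_continuous => t; apply: continuousB; [exact: cx|exact: cy|
    exact: cx|exact: cy].
have dhE t : a < t < b -> is_derive t 1 h (dh t).
  move=> tab; apply: (@is_derive_dotr _ _ (x - y)).
  by apply: is_deriveB; [exact: dx|exact: dy].
pose c := 2 * (n%:R * L).
have dh_le t : `|dh t| <= c * h t.
  rewrite /dh normrM gtr0_norm// /c -mulrA ler_pM2l// dotrE.
  apply: le_trans (ler_norm_sum _ _ _) _.
  apply: (@le_trans _ _ (\sum_(i < n) L * h t)); last first.
    by rewrite sumr_const card_ord -[X in X <= _]mulr_natl mulrA.
  apply: ler_sum => i _; rewrite normrM /h -sqr_enorm expr2 mulrCA.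
  apply: ler_pM => //; first exact: coord_le_enorm.
  apply: le_trans (rV_coord_le _ _) _; apply: le_trans (gL _ _) _.
  by rewrite ler_wpM2l// norm_le_enorm.
have sq (A B k : R) : 0 <= A -> 0 <= B -> A ^+ 2 <= expR (2 * k) * B ^+ 2 ->
    A <= expR k * B.
  move=> A0 B0; rewrite mulr_natl mulr2n expRD -expr2 -exprMn ler_sqr//.
  by rewrite nnegrE mulr_ge0// expR_ge0.
split; apply: sq; rewrite ?enorm_ge0// !sqr_enorm mulrA.
  apply: (gronwall_scalar ab ch dhE) => t _.
  exact: le_trans (ler_norm _) (dh_le t).
have rab s : a < s < b -> a < a + b - s < b by lra.
have dr (s : R) : is_derive s 1 (fun s => a + b - s) (0 - 1) by apply: is_deriveB.
have := @gronwall_scalar (fun s => h (a + b - s)) (fun s => dh (a + b - s) * (0 - 1))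
  c a b ab (within_continuous_reflect ch).
rewrite addrK [a + b]addrC addrK; apply.
- move=> s /rab rs; rewrite [b + a]addrC.
  exact: (@is_derive1_comp _ h (fun s => a + b - s) _ _ _ (dhE _ rs) (dr s)).
- move=> s _ /=; rewrite sub0r mulrN1; have := dh_le (b + a - s).
  by rewrite ler_norml => /andP[? _]; lra.
Qed.

End gronwall.

(** * Local Lipschitz continuity and uniqueness of solutions *)

Lemma max_lipschitz {R : realType} (c a b : R) :
  `|Num.max c a - Num.max c b| <= `|a - b|.
Proof.
by case: (leP c a) => ca; case: (leP c b) => cb; case: (ler0P (a - b)) => ab;
  rewrite ?lexx// ler_norml; apply/andP; split; lra.
Qed.

Lemma min_lipschitz {R : realType} (c a b : R) :
  `|Num.min c a - Num.min c b| <= `|a - b|.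
Proof.
by case: (leP c a) => ca; case: (leP c b) => cb; case: (ler0P (a - b)) => ab;
  rewrite ?lexx// ler_norml; apply/andP; split; lra.
Qed.

Section locally_lipschitz.
Context {R : realType} {n : nat}.
Implicit Types (p u v : 'rV[R]_n).

(** Local Lipschitz continuity at one point, with an explicit nonnegative constant: the form in
    which sums and products are estimated. *)
Definition lip_near {W : normedModType R} (g : 'rV[R]_n -> W) p : Prop :=
  exists2 U, nbhs p U & exists2 k : R, 0 <= k &
    forall u v, U u -> U v -> `|g u - g v| <= k * `|u - v|.

Lemma locally_lipschitz_near {W : normedModType R} (A : set 'rV[R]_n)
    (g : 'rV[R]_n -> W) p :
  locally_lipschitz A g -> nbhs p A -> lip_near g p.
Proof.
move=> gA pA; have [U pU] := gA _ (nbhs_singleton pA).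
move=> /pinfty_ex_gt0[k k0 gk]; exists (U `&` A); first exact: filterI.
by exists k => [|u v Uu Uv]; [exact: ltW|exact: (gk (u, v))].
Qed.

Lemma lip_near_locally {W : normedModType R} (g : 'rV[R]_n -> W) :
  (forall p, lip_near g p) -> locally_lipschitz setT g.
Proof.
move=> H p _; have [U pU [k k0 gk]] := H p; exists U => //.
apply: (@klipschitzW _ _ _ k).
  apply: (@globally_properfilter _ _ (p, p)).
  by split; split => //=; exact: nbhs_singleton pU.
by move=> [u v] /= [[Uu _] [Uv _]]; exact: gk.
Qed.

Lemma lip_near_continuous {W : normedModType R} (g : 'rV[R]_n -> W) p :
  lip_near g p -> {for p, continuous g}.
Proof.
move=> [U pU [k k0 gk]]; have Up := nbhs_singleton pU.
apply/(@cvgrPdist_le _ _ _ _ (nbhs_filter p)) => e e0.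
have k1 : 0 < k + 1 by rewrite ltr_wpDl.
have : \forall v \near p, ball p (e / (k + 1)) v.
  by apply: nbhsx_ballx; rewrite divr_gt0.
apply: filterS2 pU => v Uv.
rewrite -ball_normE/= => /ltW; rewrite ler_pdivlMr// mulrC.
apply: le_trans; apply: le_trans (gk _ _ Up Uv) _.
by rewrite ler_wpM2r// lerDl.
Qed.

(** Compactness is used on K x K. Near the diagonal the local constants apply; near a pair of
    distinct points the increments of [g] are bounded while the distance stays away from 0. A
    constant that works near a pair can be enlarged, hence the covering with [L] tending to
    infinity. *)
Lemma lip_near_compact {W : normedModType R} (g : 'rV[R]_n -> W)
    (K : set 'rV[R]_n) : compact K -> (forall p, K p -> lip_near g p) ->
  exists2 L : R, 0 < L & forall u v, K u -> K v -> `|g u - g v| <= L * `|u - v|.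
Proof.
move=> cK gK.
have /compact_near_coveringP := compact_setX cK cK.
move=> /(_ R +oo (fun L uv => `|g uv.1 - g uv.2| <= L * `|uv.1 - uv.2|) _).
case.
  move=> [p q] [/= Kp Kq].
  have [<-{q Kq}|pq] := eqVneq p q.
    have [U pU [k k0 gk]] := gK _ Kp.
    exists (U `*` U, [set L | k <= L]).
      by split; [exists (U, U)|apply: nbhs_pinfty_ge; exact: num_real].
    move=> [[u v] L] /= [[Uu Uv] kL]; apply: le_trans (gk _ _ Uu Uv) _.
    by rewrite ler_wpM2r.
  have d0 : 0 < `|p - q| / 4 by rewrite divr_gt0// normr_gt0 subr_eq0.
  have cp := lip_near_continuous (gK _ Kp).
  have cq := lip_near_continuous (gK _ Kq).
  have {}cp : nbhs p (fun u => `|g p - g u| <= 1).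
    by move/(@cvgrPdist_le _ _ _ _ (nbhs_filter p)) : cp; exact.
  have {}cq : nbhs q (fun u => `|g q - g u| <= 1).
    by move/(@cvgrPdist_le _ _ _ _ (nbhs_filter q)) : cq; exact.
  set d := `|p - q| / 4 in d0.
  (* On the chosen neighbourhoods [g u - g v] has norm at most |g p - g q| + 2, and [u], [v] remain
     at least [d] apart, [d] being a quarter of the distance from [p] to [q]. *)
  pose B := (`|g p - g q| + 2) / d.
  exists ((ball p d `&` (fun u => `|g p - g u| <= 1)) `*`
          (ball q d `&` (fun u => `|g q - g u| <= 1)), [set L | B <= L]).
    split; last by apply: nbhs_pinfty_ge; exact: num_real.
    exists (ball p d `&` (fun u => `|g p - g u| <= 1),
            ball q d `&` (fun u => `|g q - g u| <= 1)) => //=.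
    by split; apply: filterI => //; exact: nbhsx_ballx.
  move=> [[u v] L] /= [[[+ gu] [+ gv]] BL]; rewrite -!ball_normE/= => pu qv.
  have g1 : `|g u - g v| <= `|g p - g q| + 2.
    have -> : g u - g v = (g p - g q) + (- (g p - g u) + (g q - g v)).
      by rewrite opprB addrACA subrKC [- g q + _]addrA addNr add0r.
    apply: le_trans (ler_normD _ _) _; rewrite lerD2l.
    apply: le_trans (ler_normD _ _) _; rewrite normrN.
    by have -> : (2 : R) = 1 + 1 by []; exact: lerD.
  have uv : d <= `|u - v|.
    have : `|p - q| <= `|p - u| + `|u - v| + `|q - v|.
      have -> : p - q = (p - u) + (u - v) + - (q - v).
        by rewrite addrA subrK opprB addrA subrK.
      rewrite -[in leRHS](normrN (q - v)).
      by rewrite !(le_trans (ler_normD _ _))// lerD2r ler_normD.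
    have : `|p - q| = 4 * d by rewrite /d mulrC divfK.
    by move=> ->; lra.
  apply: (le_trans g1).
  have B0 : 0 <= B by rewrite divr_ge0// ?addr_ge0// ltW.
  have -> : `|g p - g q| + 2 = B * d by rewrite /B divfK// gt_eqF.
  by apply: ler_pM => //; exact: ltW.
move=> L0 [_ HL0]; exists (Num.max L0 1 + 1).
  by rewrite ltr_wpDl// le_max ler01 orbT.
move=> u v Ku Kv; apply: (HL0 _ _ (u, v)) => //.
by rewrite (@le_lt_trans _ _ (Num.max L0 1))// ?le_max ?lexx// ltrDl.
Qed.

Lemma rV_ball_compact (N : R) : compact [set u : 'rV[R]_n | `|u| <= N].
Proof.
apply: bounded_closed_compact.
  exists N; split; first exact: num_real.
  by move=> M NM u /= /le_trans; apply; exact: ltW.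
have -> : [set u : 'rV[R]_n | `|u| <= N] = Num.norm @^-1` [set x | x <= N] by [].
exact: (continuous_closedP _).1 (@norm_continuous _ _) _ (@closed_le _ N).
Qed.

(* Multiplying by a nonnegative cutoff, rather than truncating the argument,
   preserves the sign of the derivatives along the field. *)
Lemma cutoff (f : 'rV[R]_n -> 'rV[R]_n) (N : R) :
  (forall p, lip_near f p) ->
  exists chi : 'rV[R]_n -> R, exists L M : R,
    [/\ forall u, 0 <= chi u, forall u, `|u| <= N -> chi u = 1, 0 < L,
        forall u v, `|chi u *: f u - chi v *: f v| <= L * `|u - v|
      & forall u, `|chi u *: f u| <= M].
Proof.
move=> fl.
have [L L0 fL] := lip_near_compact (@rV_ball_compact (N + 1)) (fun p _ => fl p).
have : compact (f @` [set u | `|u| <= N + 1]).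
  apply: continuous_compact; last exact: rV_ball_compact.
  by apply: continuous_subspaceT => p; exact: lip_near_continuous.
move=> /compact_bounded[M0 [_ HM0]].
pose M := Num.max (M0 + 1) 0.
have M_ge0 : 0 <= M by rewrite le_max lexx orbT.
have fM u : `|u| <= N + 1 -> `|f u| <= M.
  move=> uN; rewrite le_max; apply/orP; left; apply: HM0; first by rewrite ltrDl.
  by exists u.
(* [chi] is 1-Lipschitz and vanishes from radius N + 1 on. The product rule then gives the Lipschitz
   constant L + M, with [L] and [M] taken on the ball of radius N + 1. *)
pose chi u := Num.max 0 (Num.min 1 (N + 1 - `|u|)).
have chi0 u : 0 <= chi u by rewrite le_max lexx.
have chi1 u : chi u <= 1 by rewrite ge_max ler01 ge_min lexx.
have chi_out u : N + 1 <= `|u| -> chi u = 0.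
  by move=> uN; apply/max_idPl; rewrite ge_min subr_le0 uN orbT.
have chiL u v : `|chi u - chi v| <= `|u - v|.
  apply: le_trans (max_lipschitz _ _ _) _; apply: le_trans (min_lipschitz _ _ _) _.
  have -> : N + 1 - `|u| - (N + 1 - `|v|) = `|v| - `|u| by lra.
  by rewrite distrC; exact: ler_dist_dist.
exists chi, (L + M), M; split => //.
- move=> u uN; rewrite /chi (_ : Num.min _ _ = 1); last by apply/min_idPl; lra.
  by apply/max_idPr.
- by rewrite ltr_wpDr.
- have aux u v : `|u| <= N + 1 -> `|chi u *: f u - chi v *: f v| <= (L + M) * `|u - v|.
    move=> uN; have [vN|/ltW vN] := leP `|v| (N + 1); last first.
      rewrite (chi_out v vN) scale0r subr0 normrZ -[chi u]subr0 -(chi_out v vN).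
      apply: (@le_trans _ _ (`|u - v| * M)); first by apply: ler_pM => //; exact: fM.
      by rewrite mulrC ler_wpM2r// lerDr ltW.
    have -> : chi u *: f u - chi v *: f v =
        chi u *: (f u - f v) + (chi u - chi v) *: f v.
      by rewrite scalerBr scalerBl addrA subrK.
    rewrite (le_trans (ler_normD _ _))// !normrZ mulrDl lerD//.
      rewrite ger0_norm// (le_trans _ (fL _ _ uN vN))// ler_piMl//.
    by rewrite mulrC ler_pM// fM.
  move=> u v; have [uN|/ltW uN] := leP `|u| (N + 1); first exact: aux.
  have [vN|/ltW vN] := leP `|v| (N + 1).
    by rewrite distrC [`|u - v|]distrC; exact: aux.
  by rewrite !chi_out// !scale0r subrr normr0 mulr_ge0// addr_ge0// ltW.
- move=> u; have [uN|/ltW uN] := leP `|u| (N + 1).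
    by rewrite normrZ ger0_norm// -[M]mul1r ler_pM// fM.
  by rewrite chi_out// scale0r normr0.
Qed.

End locally_lipschitz.

(** * Regularity and uniqueness of solutions on an interval *)

Section solutions.
Context {R : realType} {n : nat}.
Variable f : 'rV[R]_n -> 'rV[R]_n.
Implicit Types (x y : R -> 'rV[R]_n) (I J : set R).

Lemma is_solution_derive I x (t : R) : is_solution f I x -> nbhs t I ->
  is_derive t 1 x (f (x t)).
Proof.
move=> xI tI; apply/is_derive_slope.
have := xI t (nbhs_singleton tI); apply: cvg_trans; apply: cvg_app.
move=> A WA; have WI : (t^') I by exact: nbhs_dnbhs.
apply: (@filterS R (t^') _ (I `&` [set s | I s -> A s])) => [s [Is]|]; first exact.
exact: filterI.
Qed.

Lemma derive_is_solution I x :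
  (forall t, I t -> is_derive t 1 x (f (x t))) -> is_solution f I x.
Proof.
move=> xI t /xI/is_derive_slope; apply: cvg_trans; apply: cvg_app.
exact: cvg_within.
Qed.

Lemma is_solution_sub I J x : J `<=` I -> is_solution f I x -> is_solution f J x.
Proof.
move=> JI xI t Jt; have := xI t (JI _ Jt); apply: cvg_trans; apply: cvg_app.
by move=> A; apply: (@filterS R (t^') _ [set s | I s -> A s]) => s H /JI.
Qed.

(** Near [t] the slopes are bounded by |f (x t)| + 1, a Lipschitz estimate at [t] that remains
    meaningful at the endpoints of [I]. *)
Lemma is_solution_continuous I x : is_solution f I x -> {within I, continuous x}.
Proof.
move=> xI; apply/subspace_continuousP => t It.
apply/cvgrPdist_le => e e0.
have /cvgrPdist_le/(_ 1 ltr01) := xI t It.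
set K := `|f (x t)| + 1.
have K0 : 0 < K by rewrite ltr_wpDl.
move=> H.
have {}H : nbhs t [set s | s != t -> I s ->
  `|f (x t) - (s - t)^-1 *: (x s - x t)| <= 1] by exact: H.
have : \forall s \near t, ball t (e / K) s by apply: nbhsx_ballx; rewrite divr_gt0.
move=> B.
suff : nbhs t [set s | I s -> `|x t - x s| <= e] by [].
apply: (@filterS2 _ (nbhs t) _ _ _ _ _ H B) => s {}H ts Is.
have [->|st] := eqVneq s t; first by rewrite subrr normr0 ltW.
have {}H := H st Is.
have slope : `|(s - t)^-1 *: (x s - x t)| <= K.
  rewrite -[X in `|X|](subKr (f (x t))) /K.
  by apply: le_trans (ler_normB _ _) _; rewrite lerD2l.
rewrite distrC -[x s - x t](scalerKV (_ : s - t != 0)) ?subr_eq0// normrZ.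
move: ts; rewrite /ball/= distrC => /ltW; rewrite ler_pdivlMr//.
by apply: le_trans; rewrite ler_wpM2l.
Qed.

Hypothesis f_lip : forall p, lip_near f p.

Let itv_sub I (a b : R) : is_interval I -> I a -> I b -> `[a, b] `<=` I.
Proof. by move=> iI Ia Ib t; rewrite /= in_itv/= => tab; exact: iI Ia Ib _ tab. Qed.

(** Both curves stay in a ball on the compact interval, where [f] coincides with its globally
    Lipschitz cutoff; the two-sided Gronwall estimate then carries equality from either endpoint to
    the other. *)
Lemma solutions_gronwall x y (a b : R) : a <= b ->
  is_solution f `[a, b] x -> is_solution f `[a, b] y ->
  x a = y a \/ x b = y b -> x a = y a /\ x b = y b.
Proof.
move=> ab sx sy xy.
have cx := is_solution_continuous sx; have cy := is_solution_continuous sy.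
have [N HN] : exists N, forall t, a <= t <= b -> `|x t| <= N /\ `|y t| <= N.
  have bnd z : {within `[a, b], continuous z} ->
      exists N, forall t, a <= t <= b -> `|(z t : 'rV[R]_n)| <= N.
    move=> cz.
    have /compact_bounded[N [_ HN]] := continuous_compact cz (@segment_compact _ a b).
    exists (N + 1) => t tab; apply: HN; first by rewrite ltrDl.
    by exists t => //=; rewrite in_itv.
  have [N1 H1] := bnd _ cx; have [N2 H2] := bnd _ cy.
  by exists (Num.max N1 N2) => t tab; rewrite !le_max H1// H2// orbT.
have [chi [L [M [chi0 chi1 L0 gL gM]]]] := cutoff N f_lip.
have W t : a < t < b -> a <= t <= b by case/andP => *; rewrite !ltW.
have nb t : a < t < b -> nbhs t `[a, b]%classic.
  move=> tab; apply: (@filterS _ (nbhs t) _ `]a, b[%classic).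
    exact: subset_itv_oo_cc.
  by apply: near_in_itvoo; rewrite in_itv.
have dx t : a < t < b -> is_derive t 1 x (chi (x t) *: f (x t)).
  move=> tab; rewrite chi1 ?scale1r; last by have [] := HN t (W t tab).
  exact: is_solution_derive sx (nb t tab).
have dy t : a < t < b -> is_derive t 1 y (chi (y t) *: f (y t)).
  move=> tab; rewrite chi1 ?scale1r; last by have [] := HN t (W t tab).
  exact: is_solution_derive sy (nb t tab).
have [h1 h2] := gronwall (ltW L0) gL ab cx cy dx dy.
suff : x a = y a <-> x b = y b by tauto.
have zero u v w z : enorm (u - v : 'rV[R]_n) <= expR w * enorm (z : 'rV[R]_n) ->
    z = 0 -> u = v.
  move=> + z0; rewrite z0 enorm0 mulr0 => uv; apply/eqP; rewrite -subr_eq0.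
  by apply/eqP/enorm_eq0/eqP; rewrite eq_le uv enorm_ge0.
by split=> e; [apply: (zero _ _ _ _ h1)|apply: (zero _ _ _ _ h2)]; rewrite e subrr.
Qed.

Lemma is_solution_unique I x p : is_solution f I x -> x 0 = p ->
  unique_solution f p I x.
Proof.
move=> xI x0; split=> // J y iJ J0 JI yJ y0 t Jt.
have sx := is_solution_sub JI xI.
have [t0|t0] := leP 0 t.
  have JJ := itv_sub iJ J0 Jt.
  apply: (solutions_gronwall t0 (is_solution_sub JJ yJ) (is_solution_sub JJ sx) _).2.
  by left; rewrite x0.
have JJ := itv_sub iJ Jt J0.
apply: (solutions_gronwall (ltW t0) (is_solution_sub JJ yJ) (is_solution_sub JJ sx) _).1.
by right; rewrite x0.
Qed.

End solutions.

(** * Trapped solutions and their limit sets *)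

Section trapped_solutions.
Context {R : realType} {n : nat}.
Variable f : 'rV[R]_n -> 'rV[R]_n.
Hypothesis f_lip : forall p, lip_near f p.
Implicit Types (x y : R -> 'rV[R]_n) (K : set 'rV[R]_n) (h : 'rV[R]_n -> R).

(* The trapping set is required to work for all nonnegative rescalings of the
   field, in particular for the globally Lipschitz one given by a cutoff that
   equals 1 on K; no maximal solution is needed then. *)
Lemma trapped_solution K p : compact K ->
  (forall (chi : 'rV[R]_n -> R) x, (forall u, 0 <= chi u) -> x 0 = p ->
     (forall t : R, is_derive t 1 x (chi (x t) *: f (x t))) ->
     forall t, 0 <= t -> K (x t)) ->
  exists x, [/\ x 0 = p, forall t : R, 0 <= t -> is_derive t 1 x (f (x t)) &
    forall t, 0 <= t -> K (x t)].
Proof.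
move=> /compact_bounded[N [_ KN]] trap.
have {}KN u : K u -> `|u| <= N + 1 by apply: KN; rewrite ltrDl.
have [chi [L [M [chi0 chi1 L0 gL gM]]]] := cutoff (N + 1) f_lip.
have [x [x0 dx]] := picard L0 gL gM p.
have Kx := trap chi x chi0 x0 dx.
exists x; split => // t t0.
by have := dx t; rewrite chi1 ?scale1r//; exact/KN/Kx.
Qed.

Lemma cluster_inftyP x p : cluster (x t @[t --> +oo]) p <->
  forall e T : R, 0 < e -> exists2 t, T <= t & enorm (x t - p) < e.
Proof.
split=> [xp e T e0|H A B [T [_ TA]] /nbhs_enorm_ball[d d0 dB]].
  have FT : (x t @[t --> +oo]) (x @` [set t | T <= t]).
    have : \forall t \near +oo, T <= t by apply: nbhs_pinfty_ge; exact: num_real.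
    by apply: filterS => t Tt; exists t.
  have pe : nbhs p [set q | enorm (q - p) < e].
    by apply/nbhs_enorm_ball; exists e.
  by have [_ [[t /= Tt <-] xe]] := xp _ _ FT pe; exists t.
have [t Tt tp] := H d (T + 1) d0; exists (x t); split; last exact: dB.
by apply: TA; apply: lt_le_trans Tt; rewrite ltrDl.
Qed.

(** Replaces sequences by cluster points of a filter, for which closedness and the use of
    compactness are immediate. *)
Lemma omega_limit_cluster x : omega_limit x = cluster (x t @[t --> +oo]).
Proof.
rewrite eqEsubset; split=> p.
  move=> [t t_oo xt]; apply/cluster_inftyP => e T e0.
  have pe : nbhs p [set q | enorm (q - p) < e].
    by apply/nbhs_enorm_ball; exists e.
  have h1 : \forall i \near \oo, enorm (x (t i) - p) < e by exact: xt pe.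
  have h2 : \forall i \near \oo, T <= t i by move/cvgryPge : t_oo; exact.
  have [i [? ?]] := filter_ex (filterI h1 h2).
  by exists (t i).
move=> /cluster_inftyP H.
have /choice[t Ht] (i : nat) : exists t, i%:R <= t /\ enorm (x t - p) < i.+1%:R^-1.
  have i0 : 0 < i.+1%:R^-1 :> R by rewrite invr_gt0.
  by have [t] := H _ i%:R i0; exists t.
exists t.
  apply/cvgryPge => A; near=> i; apply: (@le_trans _ _ i%:R); last by have [] := Ht i.
  by near: i; exact: nbhs_infty_ger.
move=> A /nbhs_enorm_ball[d d0 dA].
have : \forall i \near \oo, i.+1%:R^-1 < d by exact: (near_infty_natSinv_lt (PosNum d0)).
by apply: filterS => i di; apply: dA; apply: lt_trans di; have [] := Ht i.
Unshelve. all: by end_near. Qed.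

Lemma eq_omega_limit x y : (forall t, 0 <= t -> x t = y t) ->
  omega_limit x = omega_limit y.
Proof.
move=> xy; rewrite !omega_limit_cluster eqEsubset; split=> p /cluster_inftyP H;
  apply/cluster_inftyP => e T e0; have [t] := H e (Num.max 0 T) e0;
  rewrite ge_max => /andP[t0 Tt] ?; exists t => //; [rewrite -xy//|rewrite xy//].
Qed.

(** * Limit sets of solutions that stay in a compact set *)

Section omega_limit.
Variables (x : R -> 'rV[R]_n) (K : set 'rV[R]_n).
Hypothesis K_compact : compact K.
Hypothesis x_derive : forall t : R, 0 <= t -> is_derive t 1 x (f (x t)).
Hypothesis x_K : forall t, 0 <= t -> K (x t).

Let x_near_K : (x t @[t --> +oo]) K.
Proof.
have : \forall t \near +oo, 0 <= (t : R) by apply: nbhs_pinfty_ge; exact: num_real.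
by apply: filterS => t /x_K.
Qed.

Lemma omega_limit_sub : omega_limit x `<=` K.
Proof.
rewrite omega_limit_cluster clusterE => p /(_ _ x_near_K).
by have /closure_id <- := compact_closed (@norm_hausdorff _ _) K_compact.
Qed.

Lemma omega_limit_nonempty : omega_limit x !=set0.
Proof.
have [p [_ xp]] := K_compact _ x_near_K.
by exists p; rewrite omega_limit_cluster.
Qed.

Lemma omega_limit_compact : compact (omega_limit x).
Proof.
apply: (subclosed_compact _ K_compact omega_limit_sub).
rewrite omega_limit_cluster clusterE; apply: closed_bigI => A _.
exact: closed_closure.
Qed.

(** Otherwise the solution is outside [A] at arbitrarily large times, and by compactness these
    positions accumulate at a limit point, which cannot lie in the open set [A]. *)
Lemma omega_limit_attracts (A : set 'rV[R]_n) : open A -> omega_limit x `<=` A ->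
  exists2 T, 0 <= T & forall t, T <= t -> A (x t).
Proof.
move=> oA xA; apply: contrapT => noT.
have /choice[t Ht] (i : nat) : exists t, i%:R <= t /\ ~ A (x t).
  apply: contrapT => H; apply: noT; exists i%:R => // t it.
  by apply: contrapT => nA; apply: H; exists t.
have uK : (x (t i) @[i --> \oo]) K.
  by exists 0%N => // i _; apply: x_K; apply: le_trans (ler0n _ i) (Ht i).1.
have [p [Kp up]] := K_compact _ uK.
have xp : omega_limit x p.
  rewrite omega_limit_cluster; apply/cluster_inftyP => e T e0.
  have FT : (x (t i) @[i --> \oo]) ((x \o t) @` [set i | T <= i%:R]).
    have : \forall i \near \oo, T <= i%:R by exact: nbhs_infty_ger.
    by apply: filterS => i Ti; exists i.
  have pe : nbhs p [set q | enorm (q - p) < e].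
    by apply/nbhs_enorm_ball; exists e.
  have [_ [[i /= Ti <-] xe]] := up _ _ FT pe.
  by exists (t i) => //; apply: le_trans Ti (Ht i).1.
have Fn : (x (t i) @[i --> \oo]) (~` A) by exists 0%N => // i _; exact: (Ht i).2.
have pA : nbhs p A by apply: open_nbhs_nbhs; split => //; exact: xA.
by have [q [nA /nA]] := up _ _ Fn pA.
Qed.

(** If h q < h p, a passage near [q] after time [T] brings [h] below the midpoint for good, which
    contradicts a later passage near [p]. *)
Lemma omega_limit_cst h T : continuous h -> 
  (forall s t, T <= s -> s <= t -> h (x t) <= h (x s)) ->
  forall p q, omega_limit x p -> omega_limit x q -> h p = h q.
Proof.
move=> ch hx.
suff le p q : omega_limit x p -> omega_limit x q -> h p <= h q.
  by move=> p q *; apply: le_anti; rewrite !le.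
rewrite omega_limit_cluster => /cluster_inftyP Hp /cluster_inftyP Hq.
rewrite leNgt; apply/negP => qp.
have nq : nbhs q [set z | h z < (h p + h q) / 2].
  have H : nbhs (h q) [set z | z < (h p + h q) / 2] by apply: lt_nbhsl; lra.
  exact: ch H.
have np : nbhs p [set z | (h p + h q) / 2 < h z].
  have H : nbhs (h p) [set z | (h p + h q) / 2 < z] by apply: lt_nbhsr; lra.
  exact: ch H.
have /nbhs_enorm_ball[d d0 dq] := nq; have /nbhs_enorm_ball[e e0 ep] := np.
have [s Ts /dq/= hs] := Hq d T d0; have [t st /ep/= ht] := Hp e s e0.
by have := hx s t Ts st; lra.
Qed.

(** A proper clopen part [B] and its complement [E] in the limit set are disjoint compact sets, at
    distance at least 2d. Their open d-neighbourhoods are disjoint and eventually contain the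
    solution, whose tail is connected yet visits both. *)
Lemma omega_limit_connected : connected (omega_limit x).
Proof.
move=> B [p0 Bp0] [G oG BG] [C cC BC].
apply: contrapT => BA.
have [q0 [q0A q0B]] : exists q, omega_limit x q /\ ~ B q.
  apply: contrapT => H; apply: BA; rewrite eqEsubset; split.
    by rewrite BG => ? [].
  by move=> q qA; apply: contrapT => nB; apply: H; exists q.
pose E := omega_limit x `&` ~` G.
have cB : compact B.
  by rewrite BC; apply: compact_closedI => //; exact: omega_limit_compact.
have cE : compact E.
  by apply: compact_closedI; [exact: omega_limit_compact|exact: open_closedC].
have q0E : E q0 by split => // q0G; apply: q0B; rewrite BG.
have BE u v : B u -> E v -> u != v.
  by rewrite BG => -[_ Gu] [_ nGv]; apply/eqP => uv; apply: nGv; rewrite -uv.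
have [d d0 dBE] : exists2 d, 0 < d & forall u v, B u -> E v -> 2 * d <= `|u - v|.
  have := @compact_EVT_min _ R (fun uv : 'rV[R]_n * 'rV[R]_n => `|uv.1 - uv.2|) (B `*` E).
  case.
  - by exists (p0, q0).
  - exact: compact_setX.
  - apply: continuous_subspaceT => uv.
    apply: continuous_comp; last exact: norm_continuous.
    by apply: continuousB; [exact: cvg_fst|exact: cvg_snd].
  move=> [u0 v0] /set_mem[/= Bu0 Ev0] H; exists (`|u0 - v0| / 2).
    by rewrite divr_gt0// normr_gt0 subr_eq0 BE.
  move=> u v Bu Ev; rewrite mulrC divfK//; apply: (H (u, v)).
  by rewrite inE.
pose U (D : set 'rV[R]_n) := \bigcup_(v in D) ball v d.
have oU D : open (U D) by apply: bigcup_open => v _; exact: ball_open.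
have DU D : D `<=` U D by move=> v Dv; exists v => //; exact: ballxx.
have UU u : U B u -> U E u -> False.
  move=> [v Bv]; rewrite -ball_normE/= => vu [w Ew]; rewrite -ball_normE/= => wu.
  have := dBE v w Bv Ew; have -> : v - w = (v - u) - (w - u).
    by rewrite opprB addrA subrK.
  by have := ler_normB (v - u) (w - u); lra.
have [|T T0 HT] := omega_limit_attracts (openU (oU B) (oU E)).
  move=> u xu; have [Gu|nGu] := pselect (G u).
    by left; apply: DU; rewrite BG.
  by right; apply: DU.
have reach D u : D u -> omega_limit x u -> exists2 t, T <= t & U D (x t).
  move=> Du; rewrite omega_limit_cluster => /cluster_inftyP H.
  have /nbhs_enorm_ball[e e0 He] : nbhs u (U D).
    by apply: open_nbhs_nbhs; split; [exact: oU|exact: DU].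
  by have [t Tt /He] := H e T e0; exists t.
have cI : connected (x @` `[T, +oo[).
  apply: connected_continuous_connected.
    by apply/connected_intervalP; exact: interval_is_interval.
  apply: continuous_in_subspaceT => t /set_mem/=; rewrite in_itv/= andbT => Tt.
  by apply: is_derive_continuous; apply: x_derive; exact: le_trans Tt.
have imT t : T <= t -> (x @` `[T, +oo[) (x t).
  by move=> Tt; exists t => //=; rewrite in_itv/= Tt.
have p0x : omega_limit x p0 by move: Bp0; rewrite BG => -[].
have [s Ts Us] := reach _ _ Bp0 p0x.
have [t Tt Ut] := reach _ _ q0E q0A.
have imB : (x @` `[T, +oo[) `&` U B = x @` `[T, +oo[.
  apply: cI.
  - by exists (x s); split => //; exact: imT.
  - by exists (U B).
  - exists (~` U E); first exact: open_closedC.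
    rewrite eqEsubset; split => u [[r Tr <-]] Ur; split; try by exists r.
      by move=> UEr; exact: UU UEr.
    by case: (HT r) => //; move: Tr; rewrite /= in_itv/= andbT.
have : (x @` `[T, +oo[) (x t) by exact: imT.
by rewrite -imB => -[_ UBt]; exact: UU UBt Ut.
Qed.

(** The cutoff field has a solution [y] through [p] on the whole line. Whenever x(r) is close to
    [p], Gronwall makes x(r + s) close to y(s), so y(s) is a limit point; it then lies in [K], where
    the cutoff is 1, so [y] solves the original equation. *)
Lemma omega_limit_invariant : invariant_set f (omega_limit x).
Proof.
move=> p xp.
have [N [_ KN]] := compact_bounded K_compact.
have {}KN u : K u -> `|u| <= N + 1 by apply: KN; rewrite ltrDl.
have [chi [L [M [chi0 chi1 L0 gL gM]]]] := cutoff (N + 1) f_lip.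
have [y [y0 dy]] := picard L0 gL gM p.
suff yx s : omega_limit x (y s).
  exists y => //; apply: is_solution_unique => //.
  apply: derive_is_solution => t _; have := dy t; rewrite chi1 ?scale1r//.
  exact/KN/omega_limit_sub.
move: xp; rewrite omega_limit_cluster => /cluster_inftyP xp.
apply/cluster_inftyP => e T e0.
pose c := expR (n%:R * L * `|s|).
have c0 : 0 < c by exact: expR_gt0.
(* [|s| <= r] keeps all times between [r] and [r + s] nonnegative, [T - s <= r] puts [r + s] beyond
   [T], and [c] is the Gronwall factor over a time [|s|]. *)
have [r + xr] := xp (e / c) (Num.max `|s| (T - s)) (divr_gt0 e0 c0).
rewrite ge_max => /andP[sr Tr].
have [sr1 sr2] : 0 <= r + s /\ 0 <= r.
  by move: sr; rewrite ler_norml => /andP[? ?]; split; lra.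
exists (r + s); first lra.
have dz (z : R) : 0 <= r + z ->
    is_derive z 1 (fun z => x (r + z)) (chi (x (r + z)) *: f (x (r + z))).
  move=> rz; have := x_derive rz; rewrite chi1 ?scale1r; last exact/KN/x_K.
  move=> /is_derive_rVP H; apply/is_derive_rVP => i.
  have dr : is_derive z 1 (fun z => r + z) (0 + 1) by exact: is_deriveD.
  have := @is_derive1_comp _ (fun t => x t 0 i) _ _ _ _ (H i) dr.
  by rewrite add0r mulr1.
suff : enorm (x (r + s) - y s) <= c * enorm (x (r + 0) - y 0).
  move=> /le_lt_trans; apply; rewrite addr0 y0.
  by move: xr; rewrite ltr_pdivlMr// mulrC.
have W a b (z : R) : a < z < b -> a <= z <= b by case/andP => *; rewrite !ltW.
have [s0|s0] := leP 0 s.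
  have rz z : 0 <= z <= s -> 0 <= r + z by move=> /andP[z0 _]; exact: addr_ge0.
  have := gronwall (ltW L0) gL s0
    (is_derive_within (fun z zs => dz z (rz z zs)))
    (is_derive_within (fun z _ => dy z))
    (fun z zs => dz z (rz z (W _ _ _ zs))) (fun z _ => dy z).
  by rewrite subr0 /c ger0_norm// => -[].
have rz z : s <= z <= 0 -> 0 <= r + z by move=> /andP[? _]; lra.
have := gronwall (ltW L0) gL (ltW s0)
    (is_derive_within (fun z zs => dz z (rz z zs)))
    (is_derive_within (fun z _ => dy z))
    (fun z zs => dz z (rz z (W _ _ _ zs))) (fun z _ => dy z).
by rewrite sub0r /c ltr0_norm// => -[].
Qed.

End omega_limit.
End trapped_solutions.

(** * Lipschitz algebra, gradients and scalar comparison *)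

Section lipschitz_algebra.
Context {R : realType} {n : nat}.
Implicit Types (p : 'rV[R]_n).

Lemma lip_near_cst {W : normedModType R} (w : W) p :
  lip_near (fun=> w) p.
Proof.
exists setT; first exact: filterT.
by exists 0 => // u v _ _; rewrite subrr normr0 mul0r.
Qed.

Lemma lip_near_eq {W : normedModType R} (g h : 'rV[R]_n -> W) p :
  (\forall u \near p, h u = g u) -> lip_near g p -> lip_near h p.
Proof.
move=> hg [U pU [k k0 gk]].
exists (U `&` [set u | h u = g u]); first exact: filterI.
by exists k => // u v [Uu ->] [Uv ->]; exact: gk.
Qed.

Lemma lip_near_ext {W : normedModType R} (g h : 'rV[R]_n -> W) p :
  (forall u, h u = g u) -> lip_near g p -> lip_near h p.
Proof. by move=> /funext ->. Qed.

Lemma lip_nearD {W : normedModType R} (g h : 'rV[R]_n -> W) p :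
  lip_near g p -> lip_near h p -> lip_near (fun u => g u + h u) p.
Proof.
move=> [U pU [k k0 gk]] [U' pU' [k' k'0 hk]].
exists (U `&` U'); first exact: filterI.
exists (k + k'); first exact: addr_ge0.
move=> u v [Uu U'u] [Uv U'v]; rewrite opprD addrACA mulrDl.
by apply: le_trans (ler_normD _ _) _; apply: lerD; [exact: gk|exact: hk].
Qed.

Lemma lip_nearN {W : normedModType R} (g : 'rV[R]_n -> W) p :
  lip_near g p -> lip_near (fun u => - g u) p.
Proof.
move=> [U pU [k k0 gk]]; exists U => //; exists k => // u v Uu Uv.
by rewrite -opprD normrN; exact: gk.
Qed.

Lemma lip_near_bounded {W : normedModType R} (g : 'rV[R]_n -> W) p :
  lip_near g p -> exists2 U, nbhs p U & exists2 B : R, 0 <= B &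
    forall u, U u -> `|g u| <= B.
Proof.
move=> /lip_near_continuous/(@cvgrPdist_le _ _ _ _ (nbhs_filter p))/(_ 1 ltr01) H.
exists [set u | `|g p - g u| <= 1]; first exact: H.
exists (`|g p| + 1); first exact: addr_ge0.
move=> u /= gu; rewrite -[g u](subKr (g p)).
by apply: le_trans (ler_normB _ _) _; rewrite lerD2l.
Qed.

Lemma lip_nearZ {W : normedModType R} (a : 'rV[R]_n -> R) (g : 'rV[R]_n -> W) p :
  lip_near a p -> lip_near g p -> lip_near (fun u => a u *: g u) p.
Proof.
move=> al gl; have [U1 pU1 [B B0 aB]] := lip_near_bounded al.
have [U2 pU2 [B' B'0 gB]] := lip_near_bounded gl.
have [U3 pU3 [k k0 ak]] := al; have [U4 pU4 [k' k'0 gk]] := gl.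
exists ((U1 `&` U2) `&` (U3 `&` U4)); first by apply: filterI; exact: filterI.
exists (B * k' + k * B'); first by rewrite addr_ge0// mulr_ge0.
move=> u v [[u1 u2] [u3 u4]] [[v1 v2] [v3 v4]].
have -> : a u *: g u - a v *: g v = a u *: (g u - g v) + (a u - a v) *: g v.
  by rewrite scalerBr scalerBl addrA subrK.
apply: le_trans (ler_normD _ _) _; rewrite !normrZ mulrDl lerD//.
  by rewrite -mulrA ler_pM//; [exact: aB|exact: gk].
by rewrite mulrAC ler_pM//; [exact: ak|exact: gB].
Qed.

Lemma lip_nearM (a b : 'rV[R]_n -> R) p :
  lip_near a p -> lip_near b p -> lip_near (fun u => a u * b u) p.
Proof. by move=> al bl; exact: (@lip_nearZ R^o a b p al bl). Qed.

Lemma lip_near_min (c : R) (a : 'rV[R]_n -> R) p :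
  lip_near a p -> lip_near (fun u => Num.min c (a u)) p.
Proof.
move=> [U pU [k k0 ak]]; exists U => //; exists k => // u v Uu Uv.
exact: le_trans (min_lipschitz _ _ _) (ak _ _ Uu Uv).
Qed.

Lemma lip_near_sum (I : eqType) (r : seq I) (a : I -> 'rV[R]_n -> R) p :
  (forall i, lip_near (a i) p) -> lip_near (fun u => \sum_(i <- r) a i u) p.
Proof.
move=> al; elim: r => [|i r IH].
  by apply: lip_near_ext (lip_near_cst 0 p) => u; rewrite big_nil.
by apply: lip_near_ext (lip_nearD (al i) IH) => u; rewrite big_cons.
Qed.

Lemma lip_near_rV m (g : 'rV[R]_n -> 'rV[R]_m) p :
  (forall i, lip_near (fun u => g u 0 i) p) -> lip_near g p.
Proof.
move=> gl.
have H (i : 'I_m) : exists Uk : set 'rV[R]_n * R, [/\ nbhs p Uk.1, 0 <= Uk.2 &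
    forall u v, Uk.1 u -> Uk.1 v -> `|g u 0 i - g v 0 i| <= Uk.2 * `|u - v|].
  by have [U pU [k k0 gk]] := gl i; exists (U, k).
have [Uk HUk] := choice H.
exists [set u | forall i, (Uk i).1 u].
  apply: (@filter_forall _ _ (fun i => (Uk i).1) (nbhs p) (nbhs_filter p)) => i.
  by have [] := HUk i.
have S0 : 0 <= \sum_i (Uk i).2 by apply: sumr_ge0 => i _; have [] := HUk i.
exists (\sum_i (Uk i).2) => // u v Uu Uv.
apply/(rV_norm_le _ (mulr_ge0 S0 (normr_ge0 _))) => i; rewrite !mxE.
have [_ _ gk] := HUk i; apply: le_trans (gk _ _ (Uu i) (Uv i)) _.
rewrite ler_wpM2r// (bigD1 i)//= lerDl sumr_ge0// => j _.
by have [] := HUk j.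
Qed.

Lemma lip_near_coord m (g : 'rV[R]_n -> 'rV[R]_m) p i :
  lip_near g p -> lip_near (fun u => g u 0 i) p.
Proof.
move=> [U pU [k k0 gk]]; exists U => //; exists k => // u v Uu Uv.
apply: le_trans (gk _ _ Uu Uv); apply: le_trans (rV_coord_le _ i).
by rewrite !mxE.
Qed.

Lemma lip_near_dotr m (g h : 'rV[R]_n -> 'rV[R]_m) p :
  lip_near g p -> lip_near h p -> lip_near (fun u => dotr (g u) (h u)) p.
Proof.
move=> gl hl.
have := lip_near_sum (index_enum 'I_m)
  (fun i => lip_nearM (lip_near_coord i gl) (lip_near_coord i hl)).
by apply: lip_near_ext => u; rewrite dotrE.
Qed.

End lipschitz_algebra.

(** * Gradients and the chain rule along curves *)

Section gradient.
Context {R : realType} {n : nat}.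
Implicit Types (p v : 'rV[R]_n) (h : 'rV[R]_n -> R).

Lemma diff_grad h p v : differentiable h p -> 'd h p v = dotr (grad h p) v.
Proof.
move=> dh; rewrite [in LHS](row_sum_delta v) linear_sum dotrE.
by apply: eq_bigr => i _; rewrite linearZ/= mxE /partial deriveE// mulrC.
Qed.

Lemma is_derive_grad h (x : R -> 'rV[R]_n) (t : R) v :
  differentiable h (x t) -> is_derive t 1 x v ->
  is_derive t 1 (h \o x) (dotr (grad h (x t)) v).
Proof.
move=> dh [/derivable1_diffP dx xv].
have dhx : differentiable (h \o x) t by exact: differentiable_comp.
split; first exact/derivable1_diffP.
have e : 'd x t 1 = v by rewrite -deriveE.
by rewrite deriveE// diff_comp//= e diff_grad.
Qed.

End gradient.

(** * Hitting times and monotonicity of scalar functions *)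

Section scalar_comparison.
Context {R : realType}.
Implicit Types (h v : R -> R) (a b c : R).

(** The time sought is the supremum of the times at which [h] is at most [c]; continuity shows that
    it is attained. *)
Lemma last_time_le h a b c : a <= b -> {within `[a, b], continuous h} ->
  h a <= c ->
  exists s, [/\ a <= s <= b, h s <= c & forall r, s < r <= b -> c < h r].
Proof.
move=> ab ch hac.
pose A := [set s | a <= s <= b /\ h s <= c].
have Aa : A a by rewrite /A/= lexx ab.
have As : has_sup A.
  by split; [exists a|exists b => s [/andP[]]].
have sA s : A s -> s <= sup A by have /ubP := sup_upper_bound As; exact.
have sab : a <= sup A <= b.
  rewrite sA//=; apply: ge_sup; first by exists a.
  by move=> s [/andP[]].
exists (sup A); split=> //.
  rewrite leNgt; apply/negP => cs.
  move/subspace_continuousP : ch => /(_ (sup A)); rewrite /= in_itv/= sab => /(_ isT).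
  have H : nbhs (h (sup A)) [set z | c < z] by exact: lt_nbhsr.
  move=> /(_ _ H); rewrite /within/= => /nbhs_ballP[e /= e0 He].
  have [s [sab' hs] es] := sup_adherent e0 As.
  suff : c < h s by rewrite ltNge hs.
  apply: He; last by rewrite in_itv.
  by rewrite /ball/= ger0_norm ?subr_ge0 ?sA// ltrBlDr -ltrBlDl.
move=> r /andP[sr rb]; rewrite ltNge; apply/negP => hr.
by have := sA r; rewrite leNgt sr => H; have := H (conj _ hr); rewrite rb
  (le_trans _ (ltW sr)) ?sab//; [move=> /(_ isT)|case/andP: sab].
Qed.

Lemma first_time_ge h a b c : a <= b -> {within `[a, b], continuous h} ->
  c <= h b ->
  exists s, [/\ a <= s <= b, c <= h s & forall r, a <= r < s -> h r < c].
Proof.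
move=> ab ch hbc.
have cr : {within `[a, b], continuous (fun s => - h (a + b - s))}.
  have cr := within_continuous_reflect ch.
  by move=> s; apply: continuousN; exact: cr.
have [|s [sab hs Hs]] := last_time_le ab cr (_ : _ <= - c).
  by rewrite lerN2 addrAC subrr add0r.
exists (a + b - s); split; [lra|by rewrite -lerN2|].
move=> r rs; rewrite -ltrN2; have := Hs (a + b - r).
by rewrite opprD addrA subrr add0r opprK; apply; lra.
Qed.

(** After the last time at which [h] is at most [c], the sign condition is in force and [h] cannot
    increase. *)
Lemma barrier_le h dh a b c : a <= b ->
  (forall t, a <= t <= b -> is_derive t 1 h (dh t)) -> h a <= c ->
  (forall t, a <= t <= b -> c < h t -> dh t <= 0) -> h b <= c.
Proof.
move=> ab hd hac dh0.
have [s [/andP[as_ sb] hs Hs]] := last_time_le ab (is_derive_within hd) hac.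
have W t : s <= t <= b -> a <= t <= b by case/andP => ? ->; rewrite (le_trans as_).
apply: le_trans hs; apply: (@derive_le0_nincr _ h dh s b sb).
- by apply: (@is_derive_within _ _ h dh) => t /W; exact: hd.
- by move=> t /andP[st tb]; apply/hd/W; rewrite !ltW.
- move=> t /andP[st tb]; apply: dh0; first by apply: W; rewrite !ltW.
  by apply: Hs; rewrite st ltW.
Qed.

(* The hypothesis on the derivatives says that [h + K * sqrt v] does not
   increase as long as [v] is positive; the square root is not differentiable
   at the first zero of [v], after which [v] vanishes. *)
Lemma add_sqrt_nincr h dh v dv K a b : a <= b ->
  (forall t, a <= t <= b -> is_derive t 1 h (dh t)) ->
  (forall t, a <= t <= b -> is_derive t 1 v (dv t)) ->
  (forall t, a <= t <= b -> 0 <= v t) ->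
  (forall t, a <= t <= b -> dv t <= 0) ->
  (forall t, a <= t <= b -> 0 < v t ->
     dh t + K * (dv t / (2 * Num.sqrt (v t))) <= 0) ->
  (forall t, a <= t <= b -> v t = 0 -> dh t <= 0) ->
  h b + K * Num.sqrt (v b) <= h a + K * Num.sqrt (v a).
Proof.
move=> ab hd vd v0 dv0 pos zero.
have W t : a < t < b -> a <= t <= b by case/andP => *; rewrite !ltW.
have v_nincr s t : a <= s -> s <= t -> t <= b -> v t <= v s.
  move=> as_ st tb.
  have W' r : s <= r <= t -> a <= r <= b.
    by case/andP => *; rewrite (le_trans as_)//= (le_trans _ tb).
  apply: (@derive_le0_nincr _ v dv s t st).
  - by apply: (@is_derive_within _ _ v dv) => r /W'; exact: vd.
  - by move=> r /andP[? ?]; apply/vd/W'; rewrite !ltW.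
  - by move=> r /andP[? ?]; apply/dv0/W'; rewrite !ltW.
(* [v s] may vanish, since the derivative is only needed in the open interval; the estimate thus
   reaches the first zero of [v]. *)
have step s : a <= s <= b -> (forall r, a <= r < s -> 0 < v r) ->
    h s + K * Num.sqrt (v s) <= h a + K * Num.sqrt (v a).
  move=> /andP[as_ sb] vpos.
  have W' r : a <= r <= s -> a <= r <= b.
    by case/andP => -> ? /=; rewrite (le_trans _ sb).
  have W'' r : a < r < s -> a <= r <= b.
    by case/andP => *; apply: W'; rewrite !ltW.
  apply: (@derive_le0_nincr _ (fun t => h t + K * Num.sqrt (v t))
    (fun t => dh t + K * (dv t / (2 * Num.sqrt (v t)))) a s as_).
  - have ch : {within `[a, s], continuous h}.
      by apply: (@is_derive_within _ _ h dh) => r /W'; exact: hd.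
    have cv : {within `[a, s], continuous v}.
      by apply: (@is_derive_within _ _ v dv) => r /W'; exact: vd.
    move=> t; apply: cvgD; first exact: ch.
    apply: cvgM; first exact: cvg_cst.
    by apply: (cvg_comp v Num.sqrt (cv t)); exact: sqrt_continuous.
  - move=> t tas; apply: is_deriveD; first exact: hd (W'' _ tas).
    have vt : 0 < v t by apply: vpos; case/andP: tas => *; rewrite ltW.
    have := is_derive1_comp (is_derive1_sqrt vt) (vd t (W'' t tas)).
    by rewrite mulrC => ds; exact: (@is_deriveZ R R R^o _ K _ _ _ ds).
  - move=> t tas; apply: pos; first exact: W''.
    by apply: vpos; case/andP: tas => *; rewrite ltW.
have [vb|vb] := ltP 0 (v b).
  apply: step; first by rewrite ab lexx.
  by move=> r /andP[ar rb]; apply: lt_le_trans vb _; apply: v_nincr => //; exact: ltW.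
have vb0 : v b = 0 by apply: le_anti; rewrite vb v0// ab lexx.
have cNv : {within `[a, b], continuous (fun t => - v t)}.
  have cv := is_derive_within vd.
  by move=> t; apply: continuousN; exact: cv.
have [|s [/andP[as_ sb] vs Hs]] := first_time_ge ab cNv (_ : 0 <= _).
  by rewrite vb0 oppr0.
have vz t : s <= t <= b -> v t = 0.
  case/andP => st tb; apply: le_anti; rewrite v0 ?(le_trans as_ st)//= andbT.
  by apply: le_trans (v_nincr _ _ as_ st tb) _; rewrite -oppr_ge0.
apply: le_trans (step s _ _); last 2 first.
- by rewrite as_.
- by move=> r rs; rewrite -oppr_lt0; exact: Hs.
rewrite vb0 vz ?lexx//= lerD2r.
have W' r : s <= r <= b -> a <= r <= b by case/andP => ? ->; rewrite (le_trans as_).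
apply: (@derive_le0_nincr _ h dh s b sb).
- by apply: (@is_derive_within _ _ h dh) => r /W'; exact: hd.
- by move=> r /andP[? ?]; apply/hd/W'; rewrite !ltW.
- by move=> r /andP[? ?]; apply: zero; [apply: W'; rewrite !ltW|apply: vz; rewrite !ltW].
Qed.

End scalar_comparison.

(** * The constructed vector field *)

(** The right-hand side is |grad V|^2 times the projection of grad theta onto the orthogonal
    complement of grad V. *)
Lemma tangentialE (R : realType) (n : nat) (V theta : 'rV[R]_n -> R) x :
  tangential V theta x = enorm (grad V x) ^+ 2 *: grad theta x
    - dotr (grad V x) (grad theta x) *: grad V x.
Proof.
rewrite /tangential mulmxBl mul_scalar_mx linearB/= linearZ/= trmxK; congr (_ - _).
rewrite -mulmxA trmx_mul trmxK [_ *m (grad theta x)^T]mx11_scalar tr_scalar_mx.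
by rewrite mul_scalar_mx.
Qed.

Section convergence.
Variables (R : realType) (n : nat).
Variables (V theta : 'rV[R]_n -> R).
Hypothesis V_ge0 : forall x, 0 <= V x.
Hypotheses (V_C1 : C1 V) (theta_C1 : C1 theta).
Hypothesis V_lip : forall j, locally_lipschitz setT (partial j V).
Hypothesis theta_lip : forall j, locally_lipschitz setT (partial j theta).
Variable S : set 'rV[R]_n.
Hypothesis S_grad : S = [set x | enorm (grad V x) = 0].
Hypothesis S_zero : S = [set x | V x = 0].
Hypothesis sublevel_compact : forall z y : 'rV[R]_n, V y <= V z ->
  compact [set x | V x <= V z /\ theta x <= theta y].
Variable Omega : 'rV[R]_n -> R.
Hypothesis Omega_ge0 : forall x, 0 <= Omega x.
Hypothesis Omega_cont : continuous Omega.
Hypothesis Omega_lip : locally_lipschitz setT Omega.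
Hypothesis Omega_gt0 : forall x, ~ S x -> 0 < Omega x.
Hypothesis Omega_eq0 : forall x, S x -> Omega x = 0.
Variable gamma : 'rV[R]_n -> R.
Hypothesis gamma_cont : {within [set x | Omega x < 1], continuous gamma}.
Hypothesis gamma_gt0 : forall x, Omega x < 1 -> 0 < gamma x.
Variable F : 'rV[R]_n -> 'rV[R]_n.
Hypothesis F_lip : locally_lipschitz [set x | Omega x < 1] F.
Hypothesis gamma_grad : forall x, Omega x < 1 ->
  gamma x * enorm (grad V x) ^+ 2 >= V x.
Hypothesis VF_le0 : forall x, Omega x < 1 -> dotr (grad V x) (F x) <= 0.
Hypothesis thetaF_le0 : forall x, Omega x < 1 -> dotr (grad theta x) (F x) <= 0.
Variable psi : 'rV[R]_n -> R.
Hypothesis psi_gt0 : forall x, 0 < psi x.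
Hypothesis psi_lip : locally_lipschitz setT psi.
Hypothesis psi_prop : forall z, exists y, [/\ V y <= V z, theta z <= theta y &
  [set x | 0 < afun V theta psi x /\ V x <= V z]
    `<=` [set x | theta x <= theta y]].
Variable beta : R.
Hypothesis beta_gt1 : 1 < beta.
Variable sigma : 'rV[R]_n -> R.
Hypothesis sigma_gt0 : forall x, 0 < sigma x.
Hypothesis sigma_lip : locally_lipschitz setT sigma.

Let f := vfield V theta Omega psi sigma F beta.
Let m x := Num.min 1 (beta * Omega x).
Implicit Types (p q u : 'rV[R]_n) (x : R -> 'rV[R]_n) (t : R).

Let m_ge0 p : 0 <= m p.
Proof. by rewrite /m le_min ler01 mulr_ge0// ltW// (lt_trans ltr01). Qed.

Let m_le1 p : m p <= 1.
Proof. by rewrite /m ge_min lexx. Qed.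

Let m_eq1 p : 1 <= Omega p -> m p = 1.
Proof.
move=> w1; apply/min_idPl; rewrite -[1]mulr1 ler_pM//; exact: ltW.
Qed.

Let m_gt0 p : ~ S p -> 0 < m p.
Proof.
move=> /Omega_gt0 O0; rewrite /m lt_min ltr01 mulr_gt0//.
exact: lt_trans beta_gt1.
Qed.

(** One formula covers both branches because the coefficient of [F] is 0 wherever [m] is 1. *)
Lemma vfield_min p : f p = (sigma p * (1 - m p)) *: F p
  - (sigma p * m p) *: (psi p *: grad V p + tangential V theta p).
Proof.
rewrite /f /vfield /m scalerDr scalerA opprD; case: ltP => h.
  rewrite addrA; congr (_ - _ *: _ - _ *: _); ring.
by rewrite subrr mulr0 scale0r add0r mulr1 scaleNr.
Qed.

Let Omega_open : open [set u | Omega u < 1].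
Proof. exact: (continuousP _).1 Omega_cont _ (@open_lt _ 1). Qed.

(** Where Omega < 1 the formula of [vfield_min] is built from locally Lipschitz functions. Where
    Omega >= 1, the condition beta > 1 gives a whole neighbourhood on which Omega > 1/beta; there
    [m] is 1 and the term in [F] is absent. *)
Lemma vfield_lip_near p : lip_near f p.
Proof.
have gl h : (forall j, locally_lipschitz setT (partial j h)) -> lip_near (grad h) p.
  move=> hl; apply: lip_near_rV => i.
  have := locally_lipschitz_near (hl i) (@filterT _ _ (nbhs_filter p)).
  by apply: lip_near_ext => u; rewrite mxE.
have Vl := gl _ V_lip; have tl := gl _ theta_lip.
have loc (W : normedModType R) (h : 'rV[R]_n -> W) :
  locally_lipschitz setT h -> lip_near h p.
  by move=> hl; exact: (locally_lipschitz_near hl (@filterT _ _ (nbhs_filter p))).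
have Ol := loc _ _ Omega_lip; have pl := loc _ _ psi_lip; have sl := loc _ _ sigma_lip.
have ml : lip_near m p.
  by apply: lip_near_min; apply: lip_nearM Ol; exact: lip_near_cst.
have Tl : lip_near (fun u => psi u *: grad V u + tangential V theta u) p.
  apply: lip_nearD; first exact: lip_nearZ.
  apply: (lip_near_ext (tangentialE V theta)); apply: lip_nearD.
    apply: lip_nearZ tl; have := lip_near_dotr Vl Vl.
    by apply: lip_near_ext => u; rewrite sqr_enorm.
  have dl := lip_near_dotr Vl tl.
  by apply: lip_nearN; exact: lip_nearZ dl Vl.
have Hl : lip_near (fun u => - ((sigma u * m u) *:
    (psi u *: grad V u + tangential V theta u))) p.
  by apply: lip_nearN; apply: lip_nearZ Tl; exact: lip_nearM.
have [w1|w1] := ltP (Omega p) 1.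
  apply: (lip_near_ext vfield_min); apply: lip_nearD Hl.
  apply: lip_nearZ.
    apply: lip_nearM sl _; apply: lip_nearD; first exact: lip_near_cst.
    exact: lip_nearN.
  by apply: locally_lipschitz_near F_lip _; apply: open_nbhs_nbhs.
apply: lip_near_eq Hl.
have bO : beta^-1 < Omega p by apply: lt_le_trans w1; rewrite invf_lt1// (lt_trans ltr01).
have : nbhs p [set u | beta^-1 < Omega u].
  by have H := @lt_nbhsr _ _ _ bO; exact: (Omega_cont H).
apply: filterS => u /= bu.
have b0 : 0 < beta by exact: lt_trans beta_gt1.
have mu : m u = 1.
  by apply/min_idPl; rewrite mulrC -ler_pdivrMr// div1r ltW.
by rewrite vfield_min mu subrr mulr0 scale0r add0r.
Qed.

Lemma grad_V_vfield_le p : dotr (grad V p) (f p) <=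
  - (sigma p * m p * psi p * enorm (grad V p) ^+ 2).
Proof.
rewrite vfield_min tangentialE dotrBr !dotrZr dotrDr dotrBr !dotrZr -!sqr_enorm.
have : sigma p * (1 - m p) * dotr (grad V p) (F p) <= 0.
  have [w1|w1] := ltP (Omega p) 1.
    by rewrite mulr_ge0_le0 ?VF_le0// mulr_ge0 ?subr_ge0// ltW.
  by rewrite (m_eq1 w1) subrr mulr0 mul0r.
by lra.
Qed.

Lemma grad_V_vfield_le0 p : dotr (grad V p) (f p) <= 0.
Proof.
apply: le_trans (grad_V_vfield_le p) _.
by rewrite oppr_le0 !mulr_ge0 ?enorm_ge0// ltW.
Qed.

(** [afun] is the scalar product of grad theta with -(psi grad V + T), T being the tangential part;
    the term in [F] only helps. *)
Lemma grad_theta_vfield_le p :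
  dotr (grad theta p) (f p) <= sigma p * m p * afun V theta psi p.
Proof.
rewrite vfield_min tangentialE dotrBr !dotrZr dotrDr dotrBr !dotrZr -!sqr_enorm.
have h1 : sigma p * (1 - m p) * dotr (grad theta p) (F p) <= 0.
  have [w1|w1] := ltP (Omega p) 1.
    by rewrite mulr_ge0_le0 ?thetaF_le0// mulr_ge0 ?subr_ge0// ltW.
  by rewrite (m_eq1 w1) subrr mulr0 mul0r.
rewrite /afun real_normK ?num_real// [dotr (grad theta p) (grad V p)]dotrC.
by lra.
Qed.

(** By Cauchy-Schwarz the last two terms of [afun] add up to something nonpositive, so only the term
    linear in grad V can make [theta] grow. *)
Lemma afun_le p :
  afun V theta psi p <= psi p * (enorm (grad V p) * enorm (grad theta p)).
Proof.
rewrite /afun.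
have h1 : `|dotr (grad V p) (grad theta p)| ^+ 2 <=
    enorm (grad V p) ^+ 2 * enorm (grad theta p) ^+ 2.
  by rewrite real_normK ?num_real// dotr_cauchy_schwarz.
have h2 : - psi p * dotr (grad V p) (grad theta p) <=
    psi p * (enorm (grad V p) * enorm (grad theta p)).
  rewrite mulNr -mulrN ler_pM2l//; apply: le_trans (dotr_le_enorm _ _).
  by rewrite -normrN ler_norm.
by lra.
Qed.

Lemma grad_theta_vfield_le_enorm p G : enorm (grad theta p) <= G ->
  dotr (grad theta p) (f p) <= sigma p * m p * psi p * (enorm (grad V p) * G).
Proof.
move=> tG; apply: le_trans (grad_theta_vfield_le p) _.
rewrite -!mulrA ler_pM2l//; rewrite ler_wpM2l//.
apply: le_trans (afun_le p) _; rewrite ler_pM2l// ler_wpM2l//.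
exact: enorm_ge0.
Qed.

Lemma gradV0 p : S p -> grad V p = 0.
Proof. by rewrite S_grad => /= /enorm_eq0. Qed.

Lemma V0 p : S p <-> V p = 0. Proof. by rewrite S_zero. Qed.

(** With A = |grad V| and c = sigma m psi, sqrt V decreases at rate at least c A / (2 sqrt Gam)
    while [theta] grows at rate at most c A G; the constant 2 sqrt Gam G is the quotient of the
    two. *)
Lemma theta_add_sqrt_le0 p G Gam : Omega p < 1 -> gamma p <= Gam ->
  enorm (grad theta p) <= G -> 0 < V p ->
  dotr (grad theta p) (f p) + 2 * Num.sqrt Gam * G *
    (dotr (grad V p) (f p) / (2 * Num.sqrt (V p))) <= 0.
Proof.
move=> w1 gG tG Vp.
have Gam0 : 0 < Gam by exact: lt_le_trans (gamma_gt0 w1) gG.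
have G0 : 0 <= G by exact: le_trans (enorm_ge0 _) tG.
have sV : 0 < Num.sqrt (V p) by rewrite sqrtr_gt0.
have sG : 0 < Num.sqrt Gam by rewrite sqrtr_gt0.
have A0 := enorm_ge0 (grad V p).
set A := enorm (grad V p) in A0 *.
have VA : Num.sqrt (V p) <= Num.sqrt Gam * A.
  rewrite -[A]ger0_norm// -sqrtr_sqr -sqrtrM ?(ltW Gam0)//.
  apply: ler_wsqrtr; apply: le_trans (gamma_grad w1) _.
  by rewrite ler_wpM2r// sqr_ge0.
have := grad_theta_vfield_le_enorm tG; have := grad_V_vfield_le p.
rewrite -/A; set c := sigma p * m p * psi p.
have c0 : 0 <= c by rewrite !mulr_ge0// ltW.
set dV := dotr (grad V p) (f p); set dt := dotr (grad theta p) (f p) => hV ht.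
have -> : 2 * Num.sqrt Gam * G * (dV / (2 * Num.sqrt (V p))) =
   Num.sqrt Gam * G * dV / Num.sqrt (V p).
  by field; rewrite gt_eqF.
suff : Num.sqrt Gam * G * dV / Num.sqrt (V p) <= - (c * (A * G)) by lra.
rewrite ler_pdivrMr//.
apply: (@le_trans _ _ (Num.sqrt Gam * G * - (c * A ^+ 2))).
  by apply: ler_wpM2l => //; rewrite mulr_ge0// ltW.
have -> : Num.sqrt Gam * G * - (c * A ^+ 2) = - (c * (A * G) * (Num.sqrt Gam * A)).
  by ring.
rewrite mulNr lerN2; apply: ler_wpM2l VA; apply: mulr_ge0 => //; exact: mulr_ge0.
Qed.

Lemma theta_vfield_le0 p : V p = 0 -> dotr (grad theta p) (f p) <= 0.
Proof.
move=> /V0/gradV0 g0.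
have := @grad_theta_vfield_le_enorm p _ (lexx _).
by rewrite g0 enorm0 mul0r mulr0.
Qed.

Let grad_continuous (h : 'rV[R]_n -> R) : C1 h -> continuous (grad h).
Proof.
move=> [_ ch] p; apply: (@rV_cvg R n _ (nbhs p) (nbhs_filter p)) => i; rewrite mxE.
have -> : (fun s => grad h s 0 i) = partial i h by apply/funext => s; rewrite mxE.
exact: ch.
Qed.

(* Near S the Lojasiewicz-type inequality [gamma |grad V|^2 >= V] makes the
   decrease of [sqrt V] compensate a possible increase of [theta]. *)
Lemma theta_sqrt_nincr (C : set 'rV[R]_n) : compact C ->
  C `<=` [set u | Omega u < 1] ->
  exists2 K : R, 0 <= K & forall x a b, a <= b ->
    (forall t, a <= t <= b -> is_derive t 1 x (f (x t)) /\ C (x t)) ->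
    theta (x b) + K * Num.sqrt (V (x b)) <= theta (x a) + K * Num.sqrt (V (x a)).
Proof.
move=> cC CO.
have bnd (h : 'rV[R]_n -> R) : {within C, continuous h} ->
    exists B, forall u, C u -> h u <= B.
  move=> ch; have [B [_ HB]] := compact_bounded (continuous_compact ch cC).
  exists (B + 1) => u Cu; apply: le_trans (ler_norm _) _; apply: HB.
    by rewrite ltrDl.
  by exists u.
have [Gam HGam] := bnd gamma (continuous_subspaceW CO gamma_cont).
have [G HG] := bnd _ (continuous_subspaceT
  (enorm_continuous (grad_continuous theta_C1))).
(* The absolute value keeps the constant nonnegative even when [C] is empty and [G] is arbitrary. *)
exists (2 * Num.sqrt Gam * `|G|); first by rewrite !mulr_ge0 ?sqrtr_ge0.
move=> x a b ab xC.
apply: (@add_sqrt_nincr _ (theta \o x) (fun t => dotr (grad theta (x t)) (f (x t)))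
  (V \o x) (fun t => dotr (grad V (x t)) (f (x t)))) => //.
- by move=> t /xC[dx _]; apply: is_derive_grad => //; exact: theta_C1.1.
- by move=> t /xC[dx _]; apply: is_derive_grad => //; exact: V_C1.1.
- by move=> t _; exact: V_ge0.
- by move=> t _; exact: grad_V_vfield_le0.
- move=> t /xC[_ Cx] Vx; apply: theta_add_sqrt_le0 => //; [exact: CO|exact: HGam|].
  exact: le_trans (HG _ Cx) (ler_norm _).
- by move=> t _; exact: theta_vfield_le0.
Qed.

(** The factor [chi] lets the same statement serve the cutoff field, before existence is known, and
    the field itself with [chi] equal to 1. *)
Lemma V_nincr (chi : 'rV[R]_n -> R) x a b : (forall u, 0 <= chi u) -> a <= b ->
  (forall t, a <= t <= b -> is_derive t 1 x (chi (x t) *: f (x t))) ->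
  V (x b) <= V (x a).
Proof.
move=> chi0 ab dx.
have dV t : a <= t <= b -> is_derive t 1 (V \o x)
    (dotr (grad V (x t)) (chi (x t) *: f (x t))).
  by move=> /dx; apply: is_derive_grad; exact: V_C1.1.
apply: (@derive_le0_nincr _ (V \o x)
  (fun t => dotr (grad V (x t)) (chi (x t) *: f (x t))) a b ab (is_derive_within dV)).
  by move=> t /andP[? ?]; apply: dV; rewrite !ltW.
by move=> t _; rewrite dotrZr mulr_ge0_le0// grad_V_vfield_le0.
Qed.

Let theta_continuous : continuous theta.
Proof. by move=> u; apply: differentiable_continuous; exact: theta_C1.1. Qed.

Let V_continuous : continuous V.
Proof. by move=> u; apply: differentiable_continuous; exact: V_C1.1. Qed.

Let theta_sqrt_continuous K : continuous (fun u => theta u + K * Num.sqrt (V u)).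
Proof.
move=> u; have cV : continuous (fun u => Num.sqrt (V u)).
  by move=> v; apply: (cvg_comp V Num.sqrt (@V_continuous v)); exact: sqrt_continuous.
have cKV : continuous (fun u => K * Num.sqrt (V u)).
  by move=> v; exact: continuousM (@cst_continuous _ _ K v) (@cV v).
exact: continuousD (@theta_continuous u) (@cKV u).
Qed.

Let absorbing z : 'rV[R]_n := sval (cid (psi_prop z)).

Let trap z : set 'rV[R]_n := [set u | V u <= V z /\ theta u <= theta (absorbing z)].

Let trap_compact z : compact (trap z).
Proof. by apply: sublevel_compact; rewrite /absorbing; case: cid => y []. Qed.

Lemma forward_solution z : exists x, [/\ x 0 = z,
  forall t, 0 <= t -> is_derive t 1 x (f (x t)) & forall t, 0 <= t -> trap z (x t)].
Proof.
apply: (trapped_solution vfield_lip_near (@trap_compact z)).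
move=> chi x chi0 x0 dx t t0.
have Vx s : 0 <= s -> V (x s) <= V z.
  by move=> s0; rewrite -x0; apply: V_nincr chi0 s0 _ => r _.
split; first exact: Vx.
have [_ zy Hy] := svalP (cid (psi_prop z)); rewrite -/(absorbing z) in zy Hy.
(* The barrier is theta(y_z), which may exceed theta(z): [theta] is allowed to grow up to that
   level. Above it, with V <= V z, the defining property of y_z forbids [afun] to be positive. *)
apply: (@barrier_le _ (theta \o x)
  (fun s => dotr (grad theta (x s)) (chi (x s) *: f (x s))) 0 t _ t0).
- by move=> s _; apply: is_derive_grad => //; exact: theta_C1.1.
- by rewrite /= x0.
move=> s /andP[s0 _] /= ys; rewrite dotrZr mulr_ge0_le0//.
apply: le_trans (grad_theta_vfield_le _) _.
rewrite mulr_ge0_le0 ?mulr_ge0 ?(ltW (sigma_gt0 _))// leNgt; apply/negP => a0.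
by have := Hy (x s) (conj a0 (Vx s s0)); rewrite /= leNgt ys.
Qed.

Let nonneg_itv t : `[0, +oo[%classic t = (0 <= t).
Proof. by rewrite /= in_itv/= andbT. Qed.

Lemma forward_unique x z : x 0 = z ->
  (forall t, 0 <= t -> is_derive t 1 x (f (x t))) ->
  unique_solution f z `[0, +oo[ x.
Proof.
move=> x0 dx; apply: is_solution_unique => //; first exact: vfield_lip_near.
by apply: derive_is_solution => t; rewrite nonneg_itv; exact: dx.
Qed.

Lemma global_bounded_solution z : exists2 x, unique_solution f z `[0, +oo[ x &
  bounded_set (x @` `[0, +oo[).
Proof.
have [x [x0 dx tx]] := forward_solution z.
exists x; first exact: forward_unique.
have [N [Nr HN]] := compact_bounded (@trap_compact z).
exists N; split=> // M /HN HM _ [t + <-]; rewrite nonneg_itv => /tx; exact: HM.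
Qed.

Lemma S_positively_invariant : positively_invariant f S.
Proof.
move=> z /V0 Vz; have [x [x0 dx tx]] := forward_solution z.
exists x; first exact: forward_unique.
by move=> t /tx[Vx _]; apply/V0/le_anti; rewrite V_ge0 andbT -Vz.
Qed.

(** * Location of the limit sets *)

Section limit_set.
Variables (x : R -> 'rV[R]_n) (C : set 'rV[R]_n).
Hypothesis C_compact : compact C.
Hypothesis x_derive : forall t, 0 <= t -> is_derive t 1 x (f (x t)).
Hypothesis x_C : forall t, 0 <= t -> C (x t).

(** LaSalle's argument: by invariance a solution through [p] stays in the limit set, along it [h] is
    constant, and its derivative at time 0 is the scalar product in question. *)
Let cst_grad (h : 'rV[R]_n -> R) p : (forall u, differentiable h u) ->
  (forall p q, omega_limit x p -> omega_limit x q -> h p = h q) ->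
  omega_limit x p -> dotr (grad h p) (f p) = 0.
Proof.
move=> dh hc xp.
have [y [sy y0 _] yx] := omega_limit_invariant vfield_lip_near C_compact x_derive x_C xp.
have dy : is_derive (0 : R) 1 y (f (y 0)).
  by apply: is_solution_derive sy _; exact: filterT.
have [_ e] := is_derive_grad (dh (y 0)) dy; rewrite y0 in e.
rewrite -e (_ : h \o y = cst (h p)) ?derive_cst//.
by apply/funext => t /=; apply: hc.
Qed.

Lemma omega_limit_subS : omega_limit x `<=` S.
Proof.
move=> p xp; apply: contrapT => nS.
have : dotr (grad V p) (f p) = 0.
  apply: cst_grad xp; first exact: V_C1.1.
  apply: (omega_limit_cst V_continuous (T := 0)) => s t s0 st.
  apply: (@V_nincr (fun=> 1)) => // r /andP[sr _].
  by rewrite scale1r; apply: x_derive; exact: le_trans sr.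
move=> dV; have := grad_V_vfield_le p; rewrite dV oppr_ge0 leNgt => /negP; apply.
apply: mulr_gt0; first by rewrite !mulr_gt0// m_gt0.
rewrite exprn_gt0// lt_def enorm_ge0 andbT.
by apply/eqP => e0; apply: nS; rewrite S_grad.
Qed.

Lemma omega_limit_critical :
  omega_limit x `<=` [set p | S p /\ dotr (grad theta p) (F p) = 0].
Proof.
move=> p xp; have Sp := omega_limit_subS xp; split=> //.
(* Any level strictly between 0 and 1 would do: the tail of the solution must lie in a compact
   subset of {Omega < 1}, which the closed condition Omega <= 1/2 in [D] provides. *)
have oO : open [set u | Omega u < 2^-1].
  exact: (continuousP _).1 Omega_cont _ (@open_lt _ _).
have xO : omega_limit x `<=` [set u | Omega u < 2^-1].
  by move=> q /omega_limit_subS/Omega_eq0 /= ->; rewrite invr_gt0.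
have [T T0 HT] := omega_limit_attracts C_compact x_C oO xO.
pose D := C `&` [set u | Omega u <= 2^-1].
have cD : compact D.
  apply: compact_closedI => //.
  exact: (continuous_closedP _).1 Omega_cont _ (@closed_le _ _).
have DO : D `<=` [set u | Omega u < 1].
  by move=> u [_] /= /le_lt_trans; apply; rewrite invf_lt1// ltr1n.
have [K K_ge0 HK] := theta_sqrt_nincr cD DO.
have c q : omega_limit x q -> theta q = theta q + K * Num.sqrt (V q).
  by move=> /omega_limit_subS/V0 ->; rewrite sqrtr0 mulr0 addr0.
have : dotr (grad theta p) (f p) = 0.
  apply: cst_grad xp; first exact: theta_C1.1.
  move=> q r xq xr; rewrite (c q xq) (c r xr).
  apply: (omega_limit_cst (@theta_sqrt_continuous K) (T := T) _ xq xr) => s t Ts st.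
  apply: HK => // z /andP[sz _].
  have z0 : T <= z by exact: le_trans sz.
  by split; [apply: x_derive; exact: le_trans z0|split; [apply: x_C; exact: le_trans z0|
    exact/ltW/HT]].
(* On [S] the field reduces to sigma F with sigma positive, so a zero derivative of [theta] along
   the field is one along [F]. *)
have m0 : m p = 0.
  by rewrite /m Omega_eq0// mulr0; apply/min_idPr.
rewrite vfield_min m0 subr0 mulr1 mulr0 scale0r subr0 dotrZr => /eqP.
by rewrite mulf_eq0 gt_eqF//= => /eqP.
Qed.

End limit_set.

Lemma omega_limit_properties z x : unique_solution f z `[0, +oo[ x ->
  [/\ omega_limit x !=set0, compact (omega_limit x),
      connected (omega_limit x), invariant_set f (omega_limit x) &
      omega_limit x `<=` [set p | S p /\ dotr (grad theta p) (F p) = 0]].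
Proof.
move=> [sx x0 _]; have [y [y0 dy ty]] := forward_solution z.
have [_ _ yuniq] := forward_unique y0 dy.
(* Uniqueness identifies the two curves on nonnegative times only, and these determine the limit
   set. *)
have -> : omega_limit x = omega_limit y.
  apply: eq_omega_limit => t t0.
  apply: (yuniq `[0, +oo[%classic) => //; rewrite ?nonneg_itv//.
  exact: interval_is_interval.
have cz := @trap_compact z.
split.
- exact: omega_limit_nonempty cz ty.
- exact: omega_limit_compact cz ty.
- exact: omega_limit_connected cz dy ty.
- exact: (@omega_limit_invariant _ _ _ vfield_lip_near _ _ cz dy ty).
- exact: omega_limit_critical cz dy ty.
Qed.

(** * Stability of an isolated strict local minimizer of theta on S *)

Section equilibrium.
Variable (p : 'rV[R]_n) (d : R).
Hypotheses (Sp : S p) (Fp : F p = 0) (d_gt0 : 0 < d).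
Hypothesis theta_min :
  forall u, S u -> u <> p -> enorm (u - p) < d -> theta p < theta u.
Hypothesis isolated : [set u | [/\ S u, dotr (grad theta u) (F u) = 0 &
  enorm (u - p) < d]] = [set p].

Let dist_continuous : continuous (fun u => enorm (u - p)).
Proof.
apply: enorm_continuous => q.
by apply: (@continuousB _ _ _ id (cst p) q) => //; exact: cst_continuous.
Qed.

Let ball_compact r : compact [set u | enorm (u - p) <= r].
Proof.
apply: bounded_closed_compact.
  exists (`|p| + r); split; first exact: num_real.
  move=> M MN u /= ur; apply: le_trans (ltW MN).
  rewrite -[u](subrK p) addrC; apply: le_trans (ler_normD _ _) _.
  by rewrite lerD2l (le_trans (norm_le_enorm _)).
exact: (continuous_closedP _).1 dist_continuous _ (@closed_le _ r).
Qed.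

Lemma vfield_equilibrium : equilibrium f p.
Proof.
rewrite /equilibrium vfield_min Fp scaler0 /m Omega_eq0// mulr0.
by rewrite (_ : Num.min _ _ = 0) ?mulr0 ?scale0r ?subr0//; apply/min_idPr.
Qed.

(** [theta] is minimal at [p] only relative to [S], so on the sphere the maximum of V and theta -
    theta(p) is used: off [S] the first is positive, on [S] the second is. Its minimum over the
    compact sphere is [mu]. *)
Let sphere_barrier r : 0 < r -> r < d -> exists2 mu : R, 0 < mu &
  forall u, enorm (u - p) = r -> V u < mu -> theta p + mu <= theta u.
Proof.
move=> r0 rd; pose Sr := [set u | enorm (u - p) = r].
have cSr : compact Sr.
  have -> : Sr = [set u | enorm (u - p) <= r] `&` [set u | r <= enorm (u - p)].
    rewrite eqEsubset; split=> u /=; first by move=> ->.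
    by move=> [? ?]; apply: le_anti; apply/andP.
  apply: compact_closedI; first exact: ball_compact.
  exact: (continuous_closedP _).1 dist_continuous _ (@closed_ge _ r).
(* The sphere is empty in dimension 0. *)
have [Sr0|/set0P] := eqVneq Sr set0.
  by exists 1 => // u ur; have : Sr u by []; rewrite Sr0.
pose M u := Num.max (V u) (theta u - theta p).
move=> Srn; have cM : {within Sr, continuous M}.
  have ct : continuous (fun u => theta u - theta p).
    move=> u.
    exact: continuousB (@theta_continuous u) (@cst_continuous _ _ (theta p) u).
  apply: continuous_subspaceT => u.
  exact: (@continuous_max _ _ V (fun u => theta u - theta p) u (@V_continuous u) (ct u)).
have [u0 /set_mem u0r Mmin] := compact_EVT_min Srn cSr cM.
exists (M u0).
  rewrite lt_max; have [Su|/V0 nSu] := pselect (S u0).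
    rewrite subr_gt0 theta_min ?orbT//; last by rewrite u0r.
    by move=> u0p; move: r0; rewrite -u0r u0p subrr enorm0 ltxx.
  by rewrite lt_def V_ge0 andbT; apply/orP; left; apply/eqP.
move=> u ur Vu; have := Mmin u (mem_set ur).
by rewrite {2}/M le_max leNgt Vu/= lerBrDl.
Qed.

(** Close to [p] both V < mu and theta + K sqrt V < theta(p) + mu hold, and both persist while the
    solution is in the ball of radius [r]; on its sphere they contradict [sphere_barrier]. *)
Lemma local_stability e : 0 < e -> exists2 del : R, 0 < del &
  forall q x, enorm (q - p) < del -> x 0 = q ->
    (forall t, 0 <= t -> is_derive t 1 x (f (x t))) ->
    forall t, 0 <= t -> enorm (x t - p) < e.
Proof.
move=> e0.
have [r1 r10 Hr1] : exists2 r : R, 0 < r &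
    forall u, enorm (u - p) < r -> Omega u < 1.
  apply/nbhs_enorm_ball; apply: open_nbhs_nbhs; split; first exact: Omega_open.
  by rewrite /= Omega_eq0.
(* Halving makes [r] strictly smaller than all three radii: [e] is the target, [d] the range of
   strict minimality, and [r1] keeps the closed ball inside {Omega < 1}. *)
pose r := Num.min e (Num.min d r1) / 2.
have r0 : 0 < r by rewrite divr_gt0// !lt_min e0 d_gt0.
have rr : r < Num.min e (Num.min d r1).
  by rewrite /r gtr_pMr ?invf_lt1 ?ltr1n// !lt_min e0 d_gt0.
move: rr; rewrite !lt_min => /and3P[re rd rr1].
have [K K_ge0 HK] := theta_sqrt_nincr (@ball_compact r)
  (fun u ur => Hr1 u (le_lt_trans ur rr1)).
have [mu mu0 Hmu] := sphere_barrier r0 rd.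
have Vp : V p = 0 by apply/V0.
have [del del0 Hdel] : exists2 del : R, 0 < del & forall u, enorm (u - p) < del ->
    [/\ enorm (u - p) < r, V u < mu & theta u + K * Num.sqrt (V u) < theta p + mu].
  apply/nbhs_enorm_ball.
  have h1 : nbhs p [set u | enorm (u - p) < r] by apply/nbhs_enorm_ball; exists r.
  have h2 : nbhs p [set u | V u < mu].
    have H : nbhs (V p) [set z | z < mu] by apply: lt_nbhsl; rewrite Vp.
    exact: V_continuous H.
  have h3 : nbhs p [set u | theta u + K * Num.sqrt (V u) < theta p + mu].
    have H : nbhs (theta p + K * Num.sqrt (V p)) [set z | z < theta p + mu].
      by apply: lt_nbhsl; rewrite Vp sqrtr0 mulr0 addr0 ltrDl.
    exact: (@theta_sqrt_continuous K _ _ H).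
  by apply: filterS (filterI h1 (filterI h2 h3)) => u [? []].
exists del => // q x /Hdel[qr Vq Wq] x0 dx t t0.
rewrite ltNge; apply/negP => et.
have cd b : {within `[0, b], continuous (fun s => enorm (x s - p))}.
  have cx : {within `[0, b], continuous x}.
    by apply: (@is_derive_within _ _ x (f \o x)) => s /andP[? _]; exact: dx.
  move=> s; apply: (cvg_comp x (fun u => enorm (u - p)) (cx s)); exact: dist_continuous.
have rt : r <= enorm (x t - p) by apply: le_trans et; exact: ltW.
have [s [/andP[s0 st] rs Hs]] := first_time_ge t0 (cd t) rt.
(* The first time outside the open ball gives only [r <=]; the intermediate value theorem gives a
   time with equality, which cannot precede [s]. *)
have xs : enorm (x s - p) = r.
  have [|c] := @IVT _ _ 0 s r s0 (cd s).
    by rewrite x0 ge_min (ltW qr) le_max rs orbT.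
  rewrite in_itv/= => /andP[c0 cs] xc.
  have [e1|cs'] := eqVneq c s; first by rewrite -e1.
  by have := Hs c; rewrite c0 lt_neqAle cs' cs xc ltxx => /(_ isT).
have xb z : 0 <= z <= s -> enorm (x z - p) <= r.
  move=> /andP[z0]; rewrite le_eqVlt => /predU1P[->|zs]; first by rewrite xs.
  by apply/ltW/Hs; rewrite z0.
have W : theta (x s) + K * Num.sqrt (V (x s)) < theta p + mu.
  apply: le_lt_trans Wq; rewrite -x0; apply: HK => // z zs; split; last exact: xb.
  by apply: dx; case/andP: zs.
have Vs : V (x s) < mu.
  apply: le_lt_trans Vq; rewrite -x0; apply: (@V_nincr (fun=> 1)) => // z /andP[z0 _].
  by rewrite scale1r; exact: dx.
have K0 : 0 <= K * Num.sqrt (V (x s)) by rewrite mulr_ge0 ?sqrtr_ge0.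
by have := Hmu _ xs Vs; lra.
Qed.

Lemma vfield_locally_asymptotically_stable : locally_asymptotically_stable f p.
Proof.
split; first exact: vfield_equilibrium.
  move=> e e0; have [del del0 H] := local_stability e0.
  exists del => // q qp; have [x [x0 dx _]] := forward_solution q.
  by exists x; [exact: forward_unique|exact: H qp x0 dx].
(* Confinement to the closed ball of radius d/2 puts the limit set within the distance [d] where [p]
   is the only critical point of [S]; it is thus reduced to [p], and a limit set attracts. *)
have d2 : 0 < d / 2 by rewrite divr_gt0.
have [del del0 H] := local_stability d2.
exists del => // q qp; have [x [x0 dx _]] := forward_solution q.
exists x; first exact: forward_unique.
have xb t : 0 <= t -> [set u | enorm (u - p) <= d / 2] (x t).
  by move=> t0; apply/ltW; exact: H qp x0 dx t t0.
have cb := @ball_compact (d / 2).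
have xp : omega_limit x `<=` [set p].
  move=> u xu; rewrite -isolated.
  have [Su Fu] := omega_limit_critical cb dx xb xu.
  split => //; apply: le_lt_trans (omega_limit_sub cb xb xu) _.
  by rewrite ltr_pdivrMr// ltr_pMr// ltr1n.
move=> A; rewrite nbhsE => -[B [oB Bp] BA].
have [|T _ HT] := omega_limit_attracts cb xb oB; first by move=> u /xp ->.
have : \forall t \near +oo, T <= t by apply: nbhs_pinfty_ge; exact: num_real.
by apply: filterS => t /HT/BA.
Qed.

End equilibrium.
End convergence.

Theorem theorem4p1 (R : realType) (n : nat)
  (V theta : 'rV[R]_n -> R)
  (V_ge0 : forall x, 0 <= V x)
  (V_C1 : C1 V) (theta_C1 : C1 theta)
  (V_lip : forall j, locally_lipschitz setT (partial j V))
  (theta_lip : forall j, locally_lipschitz setT (partial j theta))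
  (S : set 'rV[R]_n)
  (S_grad : S = [set x | enorm (grad V x) = 0])
  (S_zero : S = [set x | V x = 0])
  (sublevel_compact : forall z y : 'rV[R]_n, V y <= V z ->
     compact [set x | V x <= V z /\ theta x <= theta y])
  (Omega : 'rV[R]_n -> R)
  (Omega_ge0 : forall x, 0 <= Omega x)
  (Omega_cont : continuous Omega)
  (Omega_lip : locally_lipschitz setT Omega)
  (Omega_gt0 : forall x, ~ S x -> 0 < Omega x)
  (Omega_eq0 : forall x, S x -> Omega x = 0)
  (gamma : 'rV[R]_n -> R)
  (gamma_cont : {within [set x | Omega x < 1], continuous gamma})
  (gamma_gt0 : forall x, Omega x < 1 -> 0 < gamma x)
  (F : 'rV[R]_n -> 'rV[R]_n)
  (F_lip : locally_lipschitz [set x | Omega x < 1] F)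
  (gamma_grad : forall x, Omega x < 1 ->
     gamma x * enorm (grad V x) ^+ 2 >= V x)
  (VF_le0 : forall x, Omega x < 1 -> dotr (grad V x) (F x) <= 0)
  (thetaF_le0 : forall x, Omega x < 1 -> dotr (grad theta x) (F x) <= 0)
  (psi : 'rV[R]_n -> R)
  (psi_gt0 : forall x, 0 < psi x)
  (psi_lip : locally_lipschitz setT psi)
  (psi_prop : forall z, exists y, [/\ V y <= V z, theta z <= theta y &
     [set x | 0 < afun V theta psi x /\ V x <= V z]
       `<=` [set x | theta x <= theta y]])
  (beta : R) (beta_gt1 : 1 < beta)
  (sigma : 'rV[R]_n -> R)
  (sigma_gt0 : forall x, 0 < sigma x)
  (sigma_lip : locally_lipschitz setT sigma) :
  let f := vfield V theta Omega psi sigma F beta in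
  locally_lipschitz setT f /\
  [/\ forall x0, exists2 x, unique_solution f x0 `[0, +oo[ x &
        bounded_set (x @` `[0, +oo[),
      positively_invariant f S,
      forall x0 x, unique_solution f x0 `[0, +oo[ x ->
        [/\ omega_limit x !=set0, compact (omega_limit x),
            connected (omega_limit x), invariant_set f (omega_limit x) &
            omega_limit x
              `<=` [set p | S p /\ dotr (grad theta p) (F p) = 0]]
    & forall p, S p -> F p = 0 ->
        (exists2 d : R, 0 < d &
           (forall x, S x -> x <> p -> enorm (x - p) < d ->
              theta p < theta x) /\
           [set x | [/\ S x, dotr (grad theta x) (F x) = 0 &
                        enorm (x - p) < d]] = [set p]) ->
        locally_asymptotically_stable f p].
Proof.
move=> f; split.
  apply: lip_near_locally => p.
  exact: (vfield_lip_near V_lip theta_lip Omega_cont Omega_lip F_lip psi_lip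
    beta_gt1 sigma_lip).
split.
- move=> x0; exact: (global_bounded_solution V_C1 theta_C1 V_lip theta_lip
    sublevel_compact Omega_ge0 Omega_cont Omega_lip F_lip VF_le0 thetaF_le0
    psi_gt0 psi_lip psi_prop beta_gt1 sigma_gt0 sigma_lip).
- exact: (S_positively_invariant V_ge0 V_C1 theta_C1 V_lip theta_lip S_zero
    sublevel_compact Omega_ge0 Omega_cont Omega_lip F_lip VF_le0 thetaF_le0
    psi_gt0 psi_lip psi_prop beta_gt1 sigma_gt0 sigma_lip).
- move=> x0 x; exact: (omega_limit_properties V_ge0 V_C1 theta_C1 V_lip
    theta_lip S_grad S_zero sublevel_compact Omega_ge0 Omega_cont Omega_lip
    Omega_gt0 Omega_eq0 gamma_cont gamma_gt0 F_lip gamma_grad VF_le0 thetaF_le0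
    psi_gt0 psi_lip psi_prop beta_gt1 sigma_gt0 sigma_lip).
- move=> p Sp Fp [d d0 [theta_min isolated]].
  exact: (vfield_locally_asymptotically_stable V_ge0 V_C1 theta_C1 V_lip
    theta_lip S_grad S_zero sublevel_compact Omega_ge0 Omega_cont Omega_lip
    Omega_gt0 Omega_eq0 gamma_cont gamma_gt0 F_lip gamma_grad VF_le0 thetaF_le0
    psi_gt0 psi_lip psi_prop beta_gt1 sigma_gt0 sigma_lip Sp Fp d0 theta_min
    isolated).
Qed.
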